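(* Let $n\ge1$ and consider the Hamiltonian linear in the generators of the Jacobi group $G^J_n$, $$\mathbf{H}=\epsilon_i\mathbf{a}_i+\bar\epsilon_i\mathbf{a}_i^\dagger+\epsilon^0_{ij}\mathbf{K}^0_{ij}+\epsilon^-_{ij}\mathbf{K}^-_{ij}+\epsilon^+_{ij}\mathbf{K}^+_{ij}$$ (summation over repeated indices from $1$ to $n$), with $\epsilon=(\epsilon_i)\in\mathbb{C}^n$ and matrices $\epsilon_0=(\epsilon^0_{ij})$, $\epsilon_\pm=(\epsilon^\pm_{ij})\in M(n,\mathbb{C})$ satisfying the hermiticity conditions $$\epsilon_0^\dagger=\epsilon_0,\quad \epsilon_-=\epsilon_-^t,\quad\epsilon_+=\epsilon_+^t,\quad\epsilon_+^\dagger=\epsilon_-.$$ Write $\epsilon_-=\mathsf m+\mathrm{i}\mathsf n$, $\tfrac12\epsilon_0^t=\mathsf p+\mathrm{i}\mathsf q$ with real $n\times n$ matrices $\mathsf m=\mathsf m^t$, $\mathsf n=\mathsf n^t$, $\mathsf p=\mathsf p^t$, $\mathsf q^t=-\mathsf q$. Then the classical motion and quantum evolution generated by $\mathbf{H}$ (in the sense of the context) are described by the following first-order differential equations. a) On $\mathcal{D}^J_n$, the point $(z,W)\in\mathbb{C}^n\times\mathcal{D}_n$ satisfies $$\dot W=AW+WD+B+WCW,\qquad \dot z=(E+WF)+(A+WC)z,$$ with $$A=-\tfrac{\mathrm{i}}{2}\epsilon_0^t,\quad B=-\mathrm{i}\epsilon_-,\quad C=-\mathrm{i}\epsilon_+,\quad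 D=A^t,\quad E=-\mathrm{i}\epsilon,\quad F=-\mathrm{i}\bar\epsilon.$$ b) On $\mathcal{X}^J_n$, the point $(u,v)\in\mathbb{C}^n\times\mathcal{X}_n$ satisfies $$\dot v=Av+vD+B+vCv,\qquad \dot u=(E+vF)+(A+vC)u,$$ with $$A=\mathsf n+\mathsf q,\quad B=\mathsf m-\mathsf p,\quad C=-(\mathsf m+\mathsf p),\quad D=\mathsf n-\mathsf q,\quad E=\Im\epsilon,\quad F=-\Re\epsilon.$$ c) Under the transform $FC:(\eta,W)\mapsto(z,W)$, $z=\eta-W\bar\eta$, the differential equations in the variables $\eta\in\mathbb{C}^n$, $W\in\mathcal{D}_n$ become independent: $W$ satisfies $\dot W=AW+WD+B+WCW$ with the coefficients $A,B,C,D$ of a), and $\eta$ satisfies $$\mathrm{i}\dot\eta=\epsilon+\epsilon_-\bar\eta+\tfrac12\epsilon_0^t\eta .$$ d) Under the transform $FC_1:(\eta,v)\mapsto(u,v)$, $u=\tfrac{1}{2\mathrm{i}}[(v+\mathrm{i}\mathbb{I}_n)\eta-(v-\mathrm{i}\mathbb{I}_n)\bar\eta]$, the equations in the variables $\eta\in\mathbb{C}^n$, $v\in\mathcal{X}_n$ become independent: $\eta$ satisfies $\mathrm{i}\dot\eta=\epsilon+\epsilon_-\bar\eta+\tfrac12\epsilon_0^t\eta$, while $v$ satisfies $\dot v=Av+vD+B+vCv$ with the coefficients $A,B,C,D$ of b).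
   Context: $A^t$ is the transpose, $\bar A$ the entrywise conjugate, $A^\dagger=\bar A^t$, $\mathbb{I}_n$ the identity matrix, and a dot is the derivative with respect to real time $t$. Siegel ball: $\mathcal{D}_n=\{W\in M(n,\mathbb{C}):W=W^t,\ \mathbb{I}_n-W\bar W>0\}$; Siegel upper half plane: $\mathcal{X}_n=\{v=s+\mathrm{i}r:s,r\in M(n,\mathbb{R})\text{ symmetric},\ r>0\}$. Siegel–Jacobi ball: $\mathcal{D}^J_n=\mathbb{C}^n\times\mathcal{D}_n\ni(z,W)$; Siegel–Jacobi upper half plane: $\mathcal{X}^J_n$, points $(v,u)$ (also written $(u,v)$) with $v\in\mathcal{X}_n,u\in\mathbb{C}^n$. They are identified by the partial Cayley transform $\Phi:\mathcal{X}^J_n\to\mathcal{D}^J_n$, $W=(v-\mathrm{i}\mathbb{I}_n)(v+\mathrm{i}\mathbb{I}_n)^{-1}$, $z=2\mathrm{i}(v+\mathrm{i}\mathbb{I}_n)^{-1}u$, with inverse $v=\mathrm{i}(\mathbb{I}_n-W)^{-1}(\mathbb{I}_n+W)$, $u=(\mathbb{I}_n-W)^{-1}z$. The motion on $\mathcal{X}^J_n$ is the motion on $\mathcal{D}^J_n$ transported by $\Phi^{-1}$. Generators as holomorphic differential operators on $\mathcal{D}^J_n$: with $\nabla_{ij}=\nabla_{ji}=\frac{1+\delta_{ij}}{2}\frac{\partial}{\partial w_{ij}}$ (no summation; $w_{ij}=w_{ji}$ is one variable), and $k$ the weight, $$\mathbf{a}_l=\frac{\partial}{\partial z_l},\quad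 \mathbf{a}_l^\dagger=z_l+w_{li}\frac{\partial}{\partial z_i},\quad \mathbf{K}^-_{lm}=\nabla_{lm},\quad \mathbf{K}^0_{lm}=\tfrac{k}{4}\delta_{lm}+\tfrac{z_l}{2}\frac{\partial}{\partial z_m}+w_{li}\nabla_{im},$$ $$\mathbf{K}^+_{lm}=\tfrac{k}{2}w_{lm}+\tfrac{z_lz_m}{2}+\tfrac12(z_mw_{il}+z_lw_{im})\frac{\partial}{\partial z_i}+w_{\alpha m}w_{li}\nabla_{i\alpha}.$$ Equations of motion: let $\mathbf{H}=\sum_\lambda\epsilon_\lambda\mathbf{X}_\lambda$ with each $\mathbf{X}_\lambda$ acting as $P_\lambda+\sum_\beta Q_{\lambda,\beta}\,\partial_\beta$, where $P_\lambda,Q_{\lambda,\beta}$ are polynomials in the holomorphic coordinates $\zeta_\beta$ (here the independent coordinates $z_i$, $1\le i\le n$, and $w_{pq}$, $p\le q$). The classical motion generated by $\mathbf{H}$ is Berezin's motion $\dot\zeta_\alpha=\mathrm{i}\{\mathcal{H},\zeta_\alpha\}$ for the energy function $\mathcal{H}$ (the normalized coherent-state expectation value of $\mathbf{H}$) and the Poisson bracket of the Kähler form; the quantum evolution is the Schrödinger evolution of the parameter of a coherent state. In this framework both are given by the same equations of motion $$\mathrm{i}\,\dot\zeta_\alpha=\sum_\lambda\epsilon_\lambda Q_{\lambda,\alpha}\quad\text{for every coordinate }\zeta_\alpha,$$ and ''the motion generated by $\mathbf{H}$'' means the motion given by these equations. *)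

(* Defs.v *)
From mathcomp Require Import all_boot all_order all_algebra.
From mathcomp Require Import all_classical all_reals all_analysis.
From mathcomp Require Export complex.
Set Implicit Arguments.
Unset Strict Implicit.
Unset Printing Implicit Defensive.
Import Order.TTheory GRing.Theory Num.Theory.
Import numFieldNormedType.Exports.
Local Open Scope classical_set_scope.
Local Open Scope ring_scope.

Definition mxconj (R : rcfType) m n (A : 'M[R[i]]_(m, n)) : 'M[R[i]]_(m, n) :=
  map_mx (@conjc R) A.

Definition mxadj (R : rcfType) m n (A : 'M[R[i]]_(m, n)) : 'M[R[i]]_(n, m) :=
  (mxconj A)^T.

Definition mxreal (R : rcfType) m n (A : 'M[R]_(m, n)) : 'M[R[i]]_(m, n) :=
  map_mx (real_complex R) A.

Definition mxrect (R : rcfType) m n (A B : 'M[R]_(m, n)) : 'M[R[i]]_(m, n) :=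
  mxreal A + 'i%C *: mxreal B.

(* On [R[i]], [0 < c] means that [c] is real and positive. *)
Definition herm_posdef (R : rcfType) n (M : 'M[R[i]]_n) : Prop :=
  mxadj M = M /\
  forall x : 'cV[R[i]]_n, x != 0 -> 0 < (mxadj x *m M *m x) 0 0.

Definition sym_posdef (R : rcfType) n (M : 'M[R]_n) : Prop :=
  M^T = M /\ forall x : 'cV[R]_n, x != 0 -> 0 < (x^T *m M *m x) 0 0.

Definition siegel_ball (R : rcfType) n : set 'M[R[i]]_n :=
  [set W | W = W^T /\ herm_posdef (1%:M - W *m mxconj W)].

Definition siegel_upper (R : rcfType) n : set 'M[R[i]]_n :=
  [set v | exists s r : 'M[R]_n,
     [/\ v = mxrect s r, s^T = s & sym_posdef r]].

(* Points [(z, W)] of the ball and [(v, u)] of the upper half plane. *)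
Definition siegel_jacobi_ball (R : rcfType) n :
    set ('cV[R[i]]_n * 'M[R[i]]_n) :=
  [set x | siegel_ball x.2].

Definition siegel_jacobi_upper (R : rcfType) n :
    set ('M[R[i]]_n * 'cV[R[i]]_n) :=
  [set y | siegel_upper y.1].

Definition partial_cayley_inv (R : rcfType) n
    (x : 'cV[R[i]]_n * 'M[R[i]]_n) : 'M[R[i]]_n * 'cV[R[i]]_n :=
  ('i%C *: (invmx (1%:M - x.2) *m (1%:M + x.2)), invmx (1%:M - x.2) *m x.1).

Definition FC (R : rcfType) n (eta : 'cV[R[i]]_n) (W : 'M[R[i]]_n) :
    'cV[R[i]]_n * 'M[R[i]]_n :=
  (eta - W *m mxconj eta, W).

Definition FC1 (R : rcfType) n (eta : 'cV[R[i]]_n) (v : 'M[R[i]]_n) :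
    'M[R[i]]_n * 'cV[R[i]]_n :=
  (v, (2 * 'i%C)^-1 *: ((v + 'i%C%:M) *m eta - (v - 'i%C%:M) *m mxconj eta)).

(* Derivative with respect to real time, taken on real and imaginary parts. *)
Definition cderivable (R : realType) (f : R -> R[i]) (t : R) : Prop :=
  derivable (fun s => complex.Re (f s)) t 1 /\
  derivable (fun s => complex.Im (f s)) t 1.

Definition cdot (R : realType) (f : R -> R[i]) (t : R) : R[i] :=
  (derive1 (fun s => complex.Re (f s)) t
    +i* derive1 (fun s => complex.Im (f s)) t)%C.

Definition mxderivable (R : realType) m n (M : R -> 'M[R[i]]_(m, n)) (t : R) :
    Prop :=
  forall i j, cderivable (fun s => M s i j) t.

Definition mxdot (R : realType) m n (M : R -> 'M[R[i]]_(m, n)) (t : R) :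
    'M[R[i]]_(m, n) :=
  \matrix_(i, j) cdot (fun s => M s i j) t.

Section Operators.
Variables (K : numFieldType) (n : nat).
Local Notation point := ('cV[K]_n * 'M[K]_n)%type.

Definition sj_operator := (point -> K) -> (point -> K).

Definition d_z (l : 'I_n) : sj_operator :=
  fun f x => 'D_((delta_mx l 0, 0) : point) (f : point -> K^o) x.

(* [w_ij] and [w_ji] are one variable, so for [i != j] the derivative is taken*)
(* along the symmetric direction.                                             *)
Definition d_w (i j : 'I_n) : sj_operator :=
  fun f x => 'D_((0, if i == j then delta_mx i i
                     else delta_mx i j + delta_mx j i) : point)
               (f : point -> K^o) x.

Definition nabla (i j : 'I_n) : sj_operator :=
  fun f x => (1 + (i == j)%:R) / 2 * d_w i j f x.

(* The independent coordinates: [z_i], and [w_pq] with [p <= q]. *)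
Definition sj_coord : Type :=
  ('I_n + {pq : 'I_n * 'I_n | (pq.1 <= pq.2)%N})%type.

Definition sj_coord_val (b : sj_coord) (x : point) : K :=
  match b with
  | inl i => x.1 i 0
  | inr pq => x.2 (val pq).1 (val pq).2
  end.

Definition d_coord (b : sj_coord) : sj_operator :=
  match b with
  | inl i => d_z i
  | inr pq => d_w (val pq).1 (val pq).2
  end.

(* A holomorphic function of the independent coordinates on a set [U] of      *)
(* points [(z, W)] with [W] symmetric is represented by a function on the     *)
(* ambient space, differentiable over [K] at the points of [U] (a function    *)
(* given on symmetric [W] only is precomposed with [W |-> (W + W^T) / 2]).    *)
Definition holomorphic_on (U : set point) (f : point -> K) : Prop :=
  forall x, U x -> differentiable (f : point -> K^o) x.

(* On [U], [X] is the first-order operator [P + \sum_b Q b * d_coord b];      *)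
(* for [U] the ball this determines [P] and [Q] on [U].                       *)
Definition acts_as (U : set point) (X : sj_operator)
    (P : point -> K) (Q : sj_coord -> point -> K) : Prop :=
  forall f, holomorphic_on U f -> forall x, U x ->
    X f x = P x * f x + \sum_(b : sj_coord) Q b x * d_coord b f x.

Definition op_a (l : 'I_n) : sj_operator := d_z l.

Definition op_adag (l : 'I_n) : sj_operator := fun f x =>
  x.1 l 0 * f x + \sum_i x.2 l i * d_z i f x.

Definition op_Kminus (l m : 'I_n) : sj_operator := nabla l m.

Definition op_K0 (k : K) (l m : 'I_n) : sj_operator := fun f x =>
  k / 4 * (l == m)%:R * f x + x.1 l 0 / 2 * d_z m f x
  + \sum_i x.2 l i * nabla i m f x.

Definition op_Kplus (k : K) (l m : 'I_n) : sj_operator := fun f x =>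
  (k / 2 * x.2 l m + x.1 l 0 * x.1 m 0 / 2) * f x
  + \sum_i 2^-1 * (x.1 m 0 * x.2 i l + x.1 l 0 * x.2 i m) * d_z i f x
  + \sum_i \sum_a x.2 a m * x.2 l i * nabla i a f x.

(* In order: indices of the families a, a^dagger, K^0, K^-, K^+. *)
Definition sj_generator : Type :=
  ('I_n + 'I_n + 'I_n * 'I_n + 'I_n * 'I_n + 'I_n * 'I_n)%type.

Definition gen_op (k : K) (g : sj_generator) : sj_operator :=
  match g with
  | inl (inl (inl (inl i))) => op_a i
  | inl (inl (inl (inr i))) => op_adag i
  | inl (inl (inr (i, j))) => op_K0 k i j
  | inl (inr (i, j)) => op_Kminus i j
  | inr (i, j) => op_Kplus k i j
  end.

End Operators.

(* Coefficients of [gen_op k] in the Hamiltonian. *)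
Definition ham_coef (R : rcfType) n (eps : 'cV[R[i]]_n) (e0 em ep : 'M[R[i]]_n)
    (g : sj_generator n) : R[i] :=
  match g with
  | inl (inl (inl (inl i))) => eps i 0
  | inl (inl (inl (inr i))) => conjc (eps i 0)
  | inl (inl (inr (i, j))) => e0 i j
  | inl (inr (i, j)) => em i j
  | inr (i, j) => ep i j
  end.

(* [c] is, on the time set [J], a motion in the ball generated by the         *)
(* Hamiltonian [\sum_l e l *: X l].                                           *)
Definition generated_motion (R : realType) n (L : finType)
    (e : L -> R[i]) (X : L -> sj_operator R[i] n)
    (J : set R) (c : R -> 'cV[R[i]]_n * 'M[R[i]]_n) : Prop :=
  (forall t, J t -> siegel_jacobi_ball (c t)) /\
  exists (P : L -> 'cV[R[i]]_n * 'M[R[i]]_n -> R[i])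
         (Q : L -> sj_coord n -> 'cV[R[i]]_n * 'M[R[i]]_n -> R[i]),
    (forall l, acts_as (@siegel_jacobi_ball R n) (X l) (P l) (Q l)) /\
    forall t, J t -> forall b : sj_coord n,
      cderivable (fun s => sj_coord_val b (c s)) t /\
      'i%C * cdot (fun s => sj_coord_val b (c s)) t
        = \sum_(l : L) e l * Q l b (c t).

Definition ball_motion (R : realType) n (k : R)
    (eps : 'cV[R[i]]_n) (e0 em ep : 'M[R[i]]_n) :
    set R -> (R -> 'cV[R[i]]_n * 'M[R[i]]_n) -> Prop :=
  generated_motion (ham_coef eps e0 em ep) (gen_op k%:C%C).

(* Motion in the upper half plane: the image under the inverse partial Cayley *)
(* transform of a motion in the ball.                                         *)
Definition upper_motion (R : realType) n (k : R)
    (eps : 'cV[R[i]]_n) (e0 em ep : 'M[R[i]]_n)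
    (J : set R) (d : R -> 'M[R[i]]_n * 'cV[R[i]]_n) : Prop :=
  exists c : R -> 'cV[R[i]]_n * 'M[R[i]]_n,
    ball_motion k eps e0 em ep J c /\
    forall t, J t -> d t = partial_cayley_inv (c t).

(* Main.v *)
(** The first-order parts [Q] of the generators are read off by applying them to
    the constant 1 and to the coordinate functions, and summing them gives
    [i W' = 1/2 (e0^T W + W e0) + em + W ep W] and
    [i z' = eps + W conj eps + 1/2 e0^T z + W ep z] on the ball.

    On the upper half plane, [T = (1 - W)^-1 = (1 - i v)/2] is affine in [v], so
    that [v' = 2 i T W' T], while [u = T z]; with [T W = W T = T - 1] the
    Riccati equation for [W] becomes the one for [v], whose coefficients are
    real by hermiticity.

    For [z = eta - W conj eta], the flow for [z] says that the defect [d] of the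
    equation for [eta] satisfies [d = W conj d], hence
    [(1 - W conj W) d = 0] and [d = 0].  Since [FC1] is [FC] followed by the
    inverse partial Cayley transform, d) reduces to c). *)
From HB Require Import structures.
Require Import Defs.
From mathcomp Require Import all_boot all_order all_algebra.
From mathcomp Require Import all_classical all_reals all_analysis.
From mathcomp Require Import perm ring.
Set Implicit Arguments.
Unset Strict Implicit.
Unset Printing Implicit Defensive.
Import Order.TTheory GRing.Theory Num.Theory.
Import numFieldNormedType.Exports.
Local Open Scope classical_set_scope.
Local Open Scope ring_scope.

(** * The generators as vector fields *)

(** Each clause is an equivalence, so differentiability has to be recovered along with the
    equations. Between [W] and [v] it passes through the inverse matrix [T]. From [(z, W)] to [eta]
    it needs a formula free of [conj eta], namely [(1 - W conj W) eta = z + W conj z], whose matrix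
    is invertible by the positivity that defines the ball. A motion prescribes only the coordinates
    [w_pq] with [p <= q]; the other entries and their derivatives follow from the symmetry of [W] at
    nearby times, which uses that [J] is open. The coefficients in [v] come out real because, as a
    polynomial in [i] and [v], [T = (1 - i v)/2] becomes [1 - T] under [i -> -i], while by
    hermiticity the same change exchanges [e0^T] with [e0] and [em] with [ep]. *)

Lemma differentialZ (K : numFieldType) (V : normedModType K) (f : V -> K^o)
    (x : V) (a : K) (v : V) : 'd f x (a *: v) = a * 'd f x v.
Proof. by rewrite linearZ. Qed.

Lemma differential_sum (K : numFieldType) (V : normedModType K) (f : V -> K^o)
    (x : V) (I : finType) (v : I -> V) :
  'd f x (\sum_i v i) = \sum_i 'd f x (v i).
Proof. exact: linear_sum. Qed.

Section Operators.
Variables (K : numFieldType) (n : nat).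
Local Notation point := ('cV[K]_n * 'M[K]_n)%type.

Lemma differentialZ_point (f : point -> K) (x : point) (a : K) (v : point) :
  'd (f : point -> K^o) x (a *: v) = a * 'd (f : point -> K^o) x v.
Proof. exact: differentialZ. Qed.

Lemma differentialD_point (f : point -> K) (x : point) (u v : point) :
  'd (f : point -> K^o) x (u + v)
  = 'd (f : point -> K^o) x u + 'd (f : point -> K^o) x v.
Proof. exact: (linearD ('d (f : point -> K^o) x)). Qed.

Lemma differential_sum_point (f : point -> K) (x : point) (I : finType)
    (v : I -> point) :
  'd (f : point -> K^o) x (\sum_i v i) = \sum_i 'd (f : point -> K^o) x (v i).
Proof. exact: differential_sum. Qed.

(** Basis, dual to the functions [sj_coord_val], of the tangent vectors whose matrix part is
    symmetric; off the diagonal one variable moves two entries at once. *)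
Definition coord_dir (b : sj_coord n) : point :=
  match b with
  | inl i => (delta_mx i 0, 0)
  | inr pq => (0, if (val pq).1 == (val pq).2
                  then delta_mx (val pq).1 (val pq).1
                  else delta_mx (val pq).1 (val pq).2
                       + delta_mx (val pq).2 (val pq).1)
  end.

Lemma d_coordE (b : sj_coord n) (f : point -> K) (x : point) :
  differentiable (f : point -> K^o) x ->
  d_coord b f x = 'd (f : point -> K^o) x (coord_dir b).
Proof. by case: b => [i|pq] df; apply: deriveE. Qed.

Definition sym_delta (i j : 'I_n) : 'M[K]_n :=
  2^-1 *: (delta_mx i j + delta_mx j i).

(** The weight [(1 + delta_ij)/2] in [nabla] is what makes a single formula, with the symmetrized
    matrix unit, valid both on and off the diagonal. *)
Lemma nablaE (i j : 'I_n) (f : point -> K) (x : point) :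
  differentiable (f : point -> K^o) x ->
  nabla i j f x = 'd (f : point -> K^o) x (0, sym_delta i j).
Proof.
move=> df; rewrite /nabla /d_w deriveE// /sym_delta.
set c : K := _ / 2; pose d : 'M[K]_n := if i == j then delta_mx i i
                                       else delta_mx i j + delta_mx j i.
rewrite -[LHS](differentialZ_point f x c (0, d)).
congr ('d _ _ _); congr pair; rewrite ?scaler0// /c /d.
case: (i =P j) => [->|_]; last by rewrite addr0 mul1r.
rewrite -[delta_mx _ _ + _]mulr2n -[delta_mx _ _ *+ 2]scaler_nat scalerA.
by rewrite mulrC.
Qed.

Lemma sym_point_sum (V : point) : V.2^T = V.2 ->
  V = \sum_(b : sj_coord n) sj_coord_val b V *: coord_dir b.
Proof.
move=> Wsym; set S := \sum_b _.
have S1 : S.1 = \sum_(b : sj_coord n) (sj_coord_val b V *: coord_dir b).1.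
  exact: (big_morph (fun p : point => p.1)).
have S2 : S.2 = \sum_(b : sj_coord n) (sj_coord_val b V *: coord_dir b).2.
  exact: (big_morph (fun p : point => p.2)).
rewrite [V]surjective_pairing [S]surjective_pairing {}S1 {}S2; congr pair.
  rewrite big_sumType /= [X in _ + X]big1 ?addr0; last first.
    by move=> b _; rewrite scaler0.
  by rewrite [LHS]matrix_sum_delta; apply: eq_bigr => i _; rewrite big_ord1.
rewrite big_sumType /= big1 ?add0r; last by move=> b _; rewrite scaler0.
(* It suffices to compare the entries with [i <= j], both sides being symmetric. *)
have step (i j : 'I_n) (ij : (i <= j)%N) : V.2 i j =
    (\sum_(b : {pq : 'I_n * 'I_n | (pq.1 <= pq.2)%N})
       (sj_coord_val (inr b) V *: coord_dir (inr b)).2) i j.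
  rewrite summxE (bigD1 (exist _ (i, j) ij)) //=.
  rewrite big1 ?addr0 => [|[[p q] /= pq]].
    rewrite !mxE; case: eqP => [->|/eqP ne]; rewrite !mxE !eqxx ?mulr1//=.
    by rewrite (negPf ne) /= addr0 mulr1.
  rewrite -val_eqE /= xpair_eqE negb_and => /orP ne; rewrite !mxE.
  rewrite [X in _ * X](_ : _ = 0) ?mulr0//.
  case: (p =P q) => [epq|/eqP npq].
    rewrite mxE -epq in ne *.
    case: eqP => // ip; case: eqP => // jp.
    by rewrite ip jp eqxx in ne; case: ne.
  rewrite !mxE ![i == _]eq_sym ![j == _]eq_sym.
  have -> : (p == i) && (q == j) = false.
    by case: ne => /negPf ->; rewrite ?andbF.
  case: eqP => [qi|]; case: eqP => [pj|]; rewrite ?addr0//.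
  (* Here [q = i <= j = p], which together with [p <= q] forces [p = q]. *)
  case/eqP: npq; apply/val_inj/eqP; rewrite eqn_leq pq /=.
  by rewrite qi pj.
apply/matrixP => i j; case: (leqP i j) => [ij|/ltnW ji]; first exact: step.
rewrite -{1}Wsym mxE (step _ _ ji) !summxE; apply: eq_bigr => -[[p q] pq] _ /=.
rewrite !mxE; congr (_ * _); case: ifP => _; rewrite !mxE.
  by rewrite andbC.
by rewrite addrC; congr (_%:R + _%:R); rewrite andbC.
Qed.

Lemma sum_coordE (V : point) (f : point -> K) (x : point) : V.2^T = V.2 ->
  differentiable (f : point -> K^o) x ->
  \sum_(b : sj_coord n) sj_coord_val b V * d_coord b f x
  = 'd (f : point -> K^o) x V.
Proof.
move=> Vsym df; rewrite [in RHS](sym_point_sum Vsym) differential_sum_point.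
by apply: eq_bigr => b _; rewrite d_coordE// differentialZ_point.
Qed.

Lemma is_diff_sj_coord (b : sj_coord n) (x : point) :
  is_diff x (sj_coord_val b : point -> K^o) (sj_coord_val b).
Proof.
have lin : linear (sj_coord_val b : point -> K^o).
  by case: b => [i|pq] a u v /=; rewrite !mxE.
have cont : continuous (sj_coord_val b : point -> K^o).
  move=> y; case: b {lin} => [i|pq] /=.
    apply: (@cvg_comp _ _ _ (fst : point -> _) (fun z : 'cV[K]_n => z i 0)).
      exact: cvg_fst.
    exact: coord_continuous.
  apply: (@cvg_comp _ _ _ (snd : point -> _)
    (fun W : 'M[K]_n => W (val pq).1 (val pq).2)).
    exact: cvg_snd.
  exact: coord_continuous.
pose F : {linear point -> K^o} :=
  HB.pack (sj_coord_val b : point -> K^o) (GRing.isLinear.Build _ _ _ _ _ lin).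
rewrite (_ : sj_coord_val b = F)//.
by apply: DiffDef; [exact: linear_differentiable | exact: diff_lin].
Qed.

Lemma sj_coord_val_dir (b c : sj_coord n) :
  sj_coord_val b (coord_dir c) = (b == c)%:R.
Proof.
case: b => [i|[[p q] /= pq]]; case: c => [j|[[p' q'] /= pq']] /=.
- by rewrite mxE eqxx andbT.
- by rewrite mxE.
- by rewrite mxE.
rewrite -[inr _ == inr _]/((p, q) == (p', q')) xpair_eqE.
case: (p' =P q') => [<-|/eqP npq]; first by rewrite mxE.
rewrite !mxE; case: (p =P p') => [->|/eqP npp] /=.
  by rewrite [p' == q'](negPf npq) addr0.
case: (p =P q') => [pq'E|_]; rewrite ?addr0// add0r.
case: (q =P p') => // qp'; case/eqP: npq; apply/val_inj/eqP.
by rewrite eqn_leq pq' -qp' -pq'E.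
Qed.

(** The definition of a motion asks only for some [P] and [Q]; uniqueness lets an arbitrary choice
    of [Q] be replaced by the explicit vector field of the generator. *)
Lemma acts_as_uniq (U : set point) (X : sj_operator K n)
    (P P' : point -> K) (Q Q' : sj_coord n -> point -> K) :
  acts_as U X P Q -> acts_as U X P' Q' ->
  forall x, U x -> forall b, Q b x = Q' b x.
Proof.
move=> XQ XQ' x Ux b.
have d_cst (c : sj_coord n) : d_coord c (cst 1) x = 0.
  by rewrite d_coordE ?diff_cst//; exact: differentiable_cst.
have d_val (c : sj_coord n) : d_coord c (sj_coord_val b) x = (b == c)%:R.
  have [dfb dvb] := is_diff_sj_coord b x.
  by rewrite d_coordE// -sj_coord_val_dir; exact: (congr1 (@^~ _) dvb).
have PP' : P x = P' x.
  have := XQ (cst 1) (fun y _ => differentiable_cst _ _) x Ux.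
  rewrite (XQ' (cst 1) (fun y _ => differentiable_cst _ _) x Ux) !mulr1.
  by rewrite !big1 ?addr0// => c _; rewrite d_cst mulr0.
have hol : holomorphic_on U (sj_coord_val b).
  by move=> y _; have [] := is_diff_sj_coord b y.
have := XQ _ hol x Ux; rewrite (XQ' _ hol x Ux) PP' => /addrI.
have red (G : sj_coord n -> point -> K) :
    \sum_(c : sj_coord n) G c x * d_coord c (sj_coord_val b) x = G b x.
  rewrite (bigD1 b) //= d_val eqxx mulr1 big1 ?addr0// => c /negPf cb.
  by rewrite d_val eq_sym cb mulr0.
by rewrite !red.
Qed.

Definition gen_scalar (k : K) (g : sj_generator n) (x : point) : K :=
  match g with
  | inl (inl (inl (inl i))) => 0
  | inl (inl (inl (inr i))) => x.1 i 0
  | inl (inl (inr (i, j))) => k / 4 * (i == j)%:R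
  | inl (inr (i, j)) => 0
  | inr (i, j) => k / 2 * x.2 i j + x.1 i 0 * x.1 j 0 / 2
  end.

(** The first-order part is kept as one tangent vector, so that sums over generators can be computed
    as matrix products. Its matrix part is symmetric, as the expansion along [coord_dir]
    requires. *)
Definition gen_field (g : sj_generator n) (x : point) : point :=
  match g with
  | inl (inl (inl (inl l))) => (delta_mx l 0, 0)
  | inl (inl (inl (inr l))) => (\col_i x.2 l i, 0)
  | inl (inl (inr (l, m))) =>
      ((x.1 l 0 / 2) *: delta_mx m 0, \sum_i x.2 l i *: sym_delta i m)
  | inl (inr (l, m)) => (0, sym_delta l m)
  | inr (l, m) =>
      (\col_i (2^-1 * (x.1 m 0 * x.2 i l + x.1 l 0 * x.2 i m)),
       \sum_i \sum_a (x.2 a m * x.2 l i) *: sym_delta i a)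
  end.

Lemma sym_deltaC (i j : 'I_n) : sym_delta i j = sym_delta j i.
Proof. by rewrite /sym_delta addrC. Qed.

Lemma trmx_sym_delta (i j : 'I_n) : (sym_delta i j)^T = sym_delta i j.
Proof. by rewrite /sym_delta linearZ /= linearD /= !trmx_delta addrC. Qed.

Lemma gen_field_sym (g : sj_generator n) (x : point) :
  (gen_field g x).2^T = (gen_field g x).2.
Proof.
case: g => [[[[l|l]|[l m]]|[l m]]|[l m]] /=; rewrite ?trmx0//.
- rewrite linear_sum; apply: eq_bigr => i _.
  by rewrite linearZ /= trmx_sym_delta.
- exact: trmx_sym_delta.
- rewrite linear_sum; apply: eq_bigr => i _; rewrite linear_sum.
  by apply: eq_bigr => a _; rewrite linearZ /= trmx_sym_delta.
Qed.

Lemma sum_d_zE (a : 'I_n -> K) (f : point -> K) (x : point) :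
  differentiable (f : point -> K^o) x ->
  \sum_i a i * d_z i f x = 'd (f : point -> K^o) x (\col_i a i, 0).
Proof.
move=> df; have -> : ((\col_i a i, 0) : point)
    = \sum_i a i *: ((delta_mx i 0, 0) : point).
  set S := \sum_i _.
  have S1 : S.1 = \sum_i a i *: delta_mx i 0.
    exact: (big_morph (fun p : point => p.1)).
  have S2 : S.2 = \sum_(i < n) a i *: (0 : 'M[K]_n).
    exact: (big_morph (fun p : point => p.2)).
  rewrite [S]surjective_pairing S1 S2; congr pair.
    rewrite [LHS]matrix_sum_delta; apply: eq_bigr => i _.
    by rewrite big_ord1 mxE.
  by rewrite big1// => i _; rewrite scaler0.
rewrite differential_sum_point; apply: eq_bigr => i _.
by rewrite differentialZ_point /d_z deriveE.
Qed.

Lemma sum_nablaE (a : 'I_n -> K) (p q : 'I_n -> 'I_n) (f : point -> K)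
    (x : point) :
  differentiable (f : point -> K^o) x ->
  \sum_i a i * nabla (p i) (q i) f x
  = 'd (f : point -> K^o) x (0, \sum_i a i *: sym_delta (p i) (q i)).
Proof.
move=> df; have -> : ((0, \sum_i a i *: sym_delta (p i) (q i)) : point)
    = \sum_i a i *: ((0, sym_delta (p i) (q i)) : point).
  set S := RHS.
  have S1 : S.1 = \sum_(i < n) a i *: (0 : 'cV[K]_n).
    exact: (big_morph (fun p : point => p.1)).
  have S2 : S.2 = \sum_i a i *: sym_delta (p i) (q i).
    exact: (big_morph (fun p : point => p.2)).
  rewrite [S]surjective_pairing S1 S2; congr pair.
  by rewrite big1// => i _; rewrite scaler0.
rewrite differential_sum_point; apply: eq_bigr => i _.
by rewrite differentialZ_point nablaE.
Qed.

Lemma gen_opE (k : K) (g : sj_generator n) (f : point -> K) (x : point) :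
  differentiable (f : point -> K^o) x ->
  gen_op k g f x
  = gen_scalar k g x * f x + 'd (f : point -> K^o) x (gen_field g x).
Proof.
move=> df.
have split (u : 'cV[K]_n) (M : 'M[K]_n) : 'd (f : point -> K^o) x (u, M)
    = 'd (f : point -> K^o) x (u, 0) + 'd (f : point -> K^o) x (0, M).
  rewrite -differentialD_point; congr ('d _ _ _).
  by congr pair; rewrite ?addr0 ?add0r.
case: g => [[[[l|l]|[l m]]|[l m]]|[l m]] /=.
- by rewrite /op_a /d_z deriveE// mul0r add0r.
- by rewrite /op_adag sum_d_zE.
- rewrite /op_K0 (sum_nablaE _ id (fun=> m))// [in RHS]split addrA.
  congr (_ + _ + _); rewrite /d_z deriveE// -differentialZ_point.
  by congr ('d _ _ _); congr pair; rewrite scaler0.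
- by rewrite /op_Kminus nablaE// mul0r add0r.
- rewrite /op_Kplus sum_d_zE// [in RHS]split addrA; congr (_ + _ + _).
  transitivity (\sum_i 'd (f : point -> K^o) x
      (0, \sum_a (x.2 a m * x.2 l i) *: sym_delta i a)).
    by apply: eq_bigr => i _; rewrite (sum_nablaE _ (fun=> i) id).
  rewrite -differential_sum_point; congr ('d _ _ _).
  rewrite [LHS]surjective_pairing; congr pair.
    rewrite (big_morph (fun p : point => p.1) (id1 := 0) (op1 := +%R))//.
    by rewrite big1.
  by rewrite (big_morph (fun p : point => p.2) (id1 := 0) (op1 := +%R)).
Qed.

Lemma gen_op_acts_as (U : set point) (k : K) (g : sj_generator n) :
  acts_as U (gen_op k g) (gen_scalar k g)
    (fun b x => sj_coord_val b (gen_field g x)).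
Proof.
move=> f hol x Ux; rewrite gen_opE ?sum_coordE//; do ?exact: hol.
exact: gen_field_sym.
Qed.

(** Contraction with [sym_delta] symmetrizes the coefficient matrix; this is how [e0] comes to act
    on both sides of [W]. *)
Lemma sum_sym_delta (a : 'M[K]_n) :
  \sum_i \sum_j a i j *: sym_delta i j = 2^-1 *: (a + a^T).
Proof.
have aT : a^T = \sum_i \sum_j a i j *: delta_mx j i.
  rewrite {1}[a]matrix_sum_delta linear_sum /=; apply: eq_bigr => i _.
  rewrite linear_sum /=; apply: eq_bigr => j _.
  by rewrite linearZ /= trmx_delta.
rewrite [X in X + _]matrix_sum_delta aT -big_split scaler_sumr /=.
apply: eq_bigr => i _; rewrite -big_split scaler_sumr /=.
apply: eq_bigr => j _; rewrite -scalerDr /sym_delta !scalerA.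
by rewrite mulrC.
Qed.

End Operators.

(** * Derivatives of complex matrix functions of real time *)

Section ComplexDerivative.
Variable R : realType.
Implicit Types (f g : R -> R[i]) (t : R) (l : R[i]).

(** A relational form that carries derivability and value together; [is_cderiveP] converts it to
    [cderivable] and [cdot]. *)
Definition is_cderive f t l :=
  is_derive t 1 (fun s => complex.Re (f s)) (complex.Re l) /\
  is_derive t 1 (fun s => complex.Im (f s)) (complex.Im l).

Let eq_is_derive (f g : R -> R) t (l : R) :
  f =1 g -> is_derive t 1 f l -> is_derive t 1 g l.
Proof. by move=> /funext ->. Qed.

Lemma is_cderiveP f t l : is_cderive f t l <-> cderivable f t /\ cdot f t = l.
Proof.
split=> [[[dr vr] [di vi]]|[[dr di] <-]].
  by split=> //; rewrite /cdot !derive1E vr vi; case: (l).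
by split; rewrite /cdot /= derive1E; exact: derivableP.
Qed.

Lemma near_eq_is_cderive f g t l :
  (\forall s \near t, f s = g s) -> is_cderive f t l -> is_cderive g t l.
Proof.
move=> fg [dr di]; split.
  by apply: near_eq_is_derive dr; apply: filterS fg => s ->.
by apply: near_eq_is_derive di; apply: filterS fg => s ->.
Qed.

Lemma eq_is_cderive f g t l : f =1 g -> is_cderive f t l -> is_cderive g t l.
Proof. by move=> /funext ->. Qed.

Lemma is_cderive_uniq f t l l' :
  is_cderive f t l -> is_cderive f t l' -> l = l'.
Proof. by move=> /is_cderiveP[_ <-] /is_cderiveP[_ <-]. Qed.

Lemma is_cderive_cst (c : R[i]) t : is_cderive (fun=> c) t 0.
Proof. by split; exact: is_derive_cst. Qed.

Lemma is_cderiveD f g t l m : is_cderive f t l -> is_cderive g t m ->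
  is_cderive (fun s => f s + g s) t (l + m).
Proof.
move=> [fr fi] [gr gi]; split; rewrite raddfD /=.
  apply: (eq_is_derive _ (is_deriveD fr gr)).
  by move=> s; rewrite raddfD.
apply: (eq_is_derive _ (is_deriveD fi gi)).
by move=> s; rewrite raddfD.
Qed.

Lemma is_cderive_conj f t l :
  is_cderive f t l -> is_cderive (fun s => conjc (f s)) t (conjc l).
Proof.
move=> [fr fi]; split.
  have -> : complex.Re (conjc l) = complex.Re l by case: (l).
  by apply: eq_is_derive fr; move=> s; case: (f s).
have -> : complex.Im (conjc l) = - complex.Im l by case: (l).
apply: (eq_is_derive _ (is_deriveN fi)).
by move=> s; rewrite !fctE; case: (f s).
Qed.

Lemma is_cderiveM f g t l m : is_cderive f t l -> is_cderive g t m ->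
  is_cderive (fun s => f s * g s) t (l * g t + f t * m).
Proof.
move=> [fr fi] [gr gi]; split.
  have H := is_deriveB (is_deriveM fr gr) (is_deriveM fi gi).
  have := eq_is_derive _ H; move/(_ (fun s => complex.Re (f s * g s))).
  have -> : complex.Re (l * g t + f t * m) =
    complex.Re (f t) *: complex.Re m + complex.Re (g t) *: complex.Re l
    - (complex.Im (f t) *: complex.Im m + complex.Im (g t) *: complex.Im l).
    case: l m (f t) (g t) {fr fi gr gi H} => [a b] [c d] [x y] [z w] /=.
    by rewrite /GRing.scale /=; ring.
  by apply; move=> s; rewrite !fctE; case: (f s) (g s) => [a b] [c d].
have H := is_deriveD (is_deriveM fr gi) (is_deriveM fi gr).
have := eq_is_derive _ H; move/(_ (fun s => complex.Im (f s * g s))).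
have -> : complex.Im (l * g t + f t * m) =
    complex.Re (f t) *: complex.Im m + complex.Im (g t) *: complex.Re l
    + (complex.Im (f t) *: complex.Re m + complex.Re (g t) *: complex.Im l).
  case: l m (f t) (g t) {fr fi gr gi H} => [a b] [c d] [x y] [z w] /=.
  by rewrite /GRing.scale /=; ring.
by apply; move=> s; rewrite !fctE; case: (f s) (g s) => [a b] [c d].
Qed.

Lemma cderivable_is f t : cderivable f t -> is_cderive f t (cdot f t).
Proof. by move=> df; apply/is_cderiveP. Qed.

Lemma is_cderive_cderivable f t l : is_cderive f t l -> cderivable f t.
Proof. by case/is_cderiveP. Qed.

(** [1/f] is [conj f / |f|^2], and the real function [N = |f|^2] does not vanish at [t]. No value is
    tracked: for matrices it comes from differentiating [M M^-1 = 1]. *)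
Lemma cderivableV f t : f t != 0 -> cderivable f t ->
  cderivable (fun s => (f s)^-1) t.
Proof.
move=> ft0 /cderivable_is [fr fi].
pose N s := complex.Re (f s) ^+ 2 + complex.Im (f s) ^+ 2.
have Nt0 : N t != 0.
  apply: contra ft0; rewrite /N paddr_eq0 ?sqr_ge0// !sqrf_eq0.
  by case: (f t) => a b /= /andP[/eqP-> /eqP->].
have dN := is_deriveV Nt0 (is_deriveD (is_deriveX 2 fr) (is_deriveX 2 fi)).
split.
  apply: (@ex_derive _ _ _ _ _ _ _ (eq_is_derive _ (is_deriveM fr dN))).
  by move=> s; rewrite !fctE /N; case: (f s).
apply: (@ex_derive _ _ _ _ _ _ _
  (eq_is_derive _ (is_deriveM (is_deriveN fi) dN))).
by move=> s; rewrite !fctE /N; case: (f s) => a b /=; rewrite mulNr.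
Qed.

Lemma is_cderive_sum (I : Type) (r : seq I) (P : pred I) (f : I -> R -> R[i])
    t (l : I -> R[i]) :
  (forall i, is_cderive (f i) t (l i)) ->
  is_cderive (fun s => \sum_(i <- r | P i) f i s) t (\sum_(i <- r | P i) l i).
Proof.
move=> df; elim: r => [|i r IH].
  rewrite big_nil; apply: eq_is_cderive (is_cderive_cst 0 t).
  by move=> s; rewrite big_nil.
rewrite big_cons; case Pi : (P i).
  apply: eq_is_cderive (is_cderiveD (df i) IH).
  by move=> s; rewrite big_cons Pi.
by apply: eq_is_cderive IH; move=> s; rewrite big_cons Pi.
Qed.

Lemma cderivable_prod (I : Type) (r : seq I) (P : pred I) (f : I -> R -> R[i])
    t :
  (forall i, cderivable (f i) t) ->
  cderivable (fun s => \prod_(i <- r | P i) f i s) t.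
Proof.
move=> df; suff [l] : exists l,
    is_cderive (fun s => \prod_(i <- r | P i) f i s) t l.
  exact: is_cderive_cderivable.
elim: r => [|i r [l IH]].
  exists 0; apply: eq_is_cderive (is_cderive_cst 1 t).
  by move=> s; rewrite big_nil.
case Pi : (P i); last first.
  exists l; apply: eq_is_cderive IH.
  by move=> s; rewrite big_cons Pi.
exists (cdot (f i) t * \prod_(j <- r | P j) f j t + f i t * l).
apply: eq_is_cderive (is_cderiveM (cderivable_is (df i)) IH).
by move=> s; rewrite big_cons Pi.
Qed.

Definition is_mxderive m n (M : R -> 'M[R[i]]_(m, n)) t (L : 'M[R[i]]_(m, n)) :=
  forall i j, is_cderive (fun s => M s i j) t (L i j).

Lemma is_mxderiveP m n (M : R -> 'M[R[i]]_(m, n)) t L :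
  is_mxderive M t L <-> mxderivable M t /\ mxdot M t = L.
Proof.
split=> [dM|[dM <-] i j]; last by rewrite mxE; exact: cderivable_is.
split=> [i j|]; first by case/is_cderiveP: (dM i j).
by apply/matrixP => i j; rewrite mxE; case/is_cderiveP: (dM i j).
Qed.

Lemma mxderivable_is m n (M : R -> 'M[R[i]]_(m, n)) t :
  mxderivable M t -> is_mxderive M t (mxdot M t).
Proof. by move=> dM; apply/is_mxderiveP. Qed.

Lemma is_mxderive_uniq m n (M : R -> 'M[R[i]]_(m, n)) t L L' :
  is_mxderive M t L -> is_mxderive M t L' -> L = L'.
Proof. by move=> /is_mxderiveP[_ <-] /is_mxderiveP[_ <-]. Qed.

Lemma near_eq_is_mxderive m n (M N : R -> 'M[R[i]]_(m, n)) t L :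
  (\forall s \near t, M s = N s) -> is_mxderive M t L -> is_mxderive N t L.
Proof.
move=> MN dM i j; apply: near_eq_is_cderive (dM i j).
by apply: filterS MN => s ->.
Qed.

Lemma eq_is_mxderive m n (M N : R -> 'M[R[i]]_(m, n)) t L :
  M =1 N -> is_mxderive M t L -> is_mxderive N t L.
Proof. by move=> /funext ->. Qed.

Lemma is_mxderive_cst m n (A : 'M[R[i]]_(m, n)) t : is_mxderive (fun=> A) t 0.
Proof. by move=> i j; rewrite mxE; exact: is_cderive_cst. Qed.

Lemma is_mxderiveD m n (M N : R -> 'M[R[i]]_(m, n)) t L P :
  is_mxderive M t L -> is_mxderive N t P ->
  is_mxderive (fun s => M s + N s) t (L + P).
Proof.
move=> dM dN i j; rewrite mxE.
apply: eq_is_cderive (is_cderiveD (dM i j) (dN i j)).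
by move=> s; rewrite mxE.
Qed.

Lemma is_mxderiveZ m n (M : R -> 'M[R[i]]_(m, n)) (a : R[i]) t L :
  is_mxderive M t L -> is_mxderive (fun s => a *: M s) t (a *: L).
Proof.
move=> dM i j; rewrite mxE -[_ * _]add0r -[0](mul0r (M t i j)).
apply: eq_is_cderive (is_cderiveM (is_cderive_cst a t) (dM i j)).
by move=> s; rewrite mxE.
Qed.

Lemma is_mxderiveN m n (M : R -> 'M[R[i]]_(m, n)) t L :
  is_mxderive M t L -> is_mxderive (fun s => - M s) t (- L).
Proof.
move=> dM; rewrite -scaleN1r.
apply: eq_is_mxderive (is_mxderiveZ (-1) dM).
by move=> s; rewrite scaleN1r.
Qed.

Lemma is_mxderiveM m n p (M : R -> 'M[R[i]]_(m, n)) (N : R -> 'M[R[i]]_(n, p))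
    t L P :
  is_mxderive M t L -> is_mxderive N t P ->
  is_mxderive (fun s => M s *m N s) t (L *m N t + M t *m P).
Proof.
move=> dM dN i j; rewrite !mxE -big_split /=.
have H := is_cderive_sum (index_enum 'I_n) xpredT
  (fun k => is_cderiveM (dM i k) (dN k j)).
by apply: eq_is_cderive H; move=> s; rewrite mxE.
Qed.

Lemma is_mxderive_conj m n (M : R -> 'M[R[i]]_(m, n)) t L :
  is_mxderive M t L -> is_mxderive (fun s => mxconj (M s)) t (mxconj L).
Proof.
move=> dM i j; rewrite mxE; apply: eq_is_cderive (is_cderive_conj (dM i j)).
by move=> s; rewrite mxE.
Qed.

Lemma cderivable_det n (M : R -> 'M[R[i]]_n) t :
  mxderivable M t -> cderivable (fun s => \det (M s)) t.
Proof.
move=> dM; have H (s : 'S_n) : is_cderive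
    (fun u => (-1) ^+ s * \prod_i M u i (s i)) t
    (0 * \prod_i M t i (s i)
      + (-1) ^+ s * cdot (fun u => \prod_i M u i (s i)) t).
  apply: is_cderiveM; first exact: is_cderive_cst.
  by apply: cderivable_is; apply: cderivable_prod => i; exact: dM.
have := is_cderive_sum (index_enum 'S_n) xpredT H.
exact: is_cderive_cderivable.
Qed.

(** By Cramer's rule an entry of the inverse is a cofactor divided by the determinant, and both of
    these are polynomials in the entries of [M]. *)
Lemma mxderivableV n (M : R -> 'M[R[i]]_n) t :
  (\forall s \near t, M s \in unitmx) -> mxderivable M t ->
  mxderivable (fun s => invmx (M s)) t.
Proof.
move=> Mu dM i j; have Mtu := nbhs_singleton Mu.
have ddet := cderivable_det dM.
have detV : cderivable (fun s => (\det (M s))^-1) t.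
  by apply: cderivableV ddet; rewrite unitmxE unitfE in Mtu.
have dcof : cderivable (fun s => cofactor (M s) j i) t.
  have dminor : cderivable (fun s => \det (row' j (col' i (M s)))) t.
    apply: cderivable_det => p q.
    apply: is_cderive_cderivable.
    apply: eq_is_cderive (cderivable_is (dM (lift j p) (lift i q))).
    by move=> s; rewrite !mxE.
  apply: is_cderive_cderivable.
  exact: is_cderiveM (is_cderive_cst _ _) (cderivable_is dminor).
apply: is_cderive_cderivable.
apply: near_eq_is_cderive
  (is_cderiveM (cderivable_is detV) (cderivable_is dcof)).
by apply: filterS Mu => s us; rewrite /invmx us !mxE.
Qed.

Lemma is_mxderiveV n (M : R -> 'M[R[i]]_n) t L :
  (\forall s \near t, M s \in unitmx) -> is_mxderive M t L ->
  is_mxderive (fun s => invmx (M s)) t (- (invmx (M t) *m L *m invmx (M t))).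
Proof.
move=> Mu dM; have Mtu := nbhs_singleton Mu.
have /mxderivable_is dV : mxderivable (fun s => invmx (M s)) t.
  by apply: mxderivableV Mu _; case/is_mxderiveP: dM.
have d1 : is_mxderive (fun s => M s *m invmx (M s)) t 0.
  apply: near_eq_is_mxderive (is_mxderive_cst 1%:M t).
  by apply: filterS Mu => s us; rewrite mulmxV.
have /eqP := is_mxderive_uniq (is_mxderiveM dM dV) d1.
rewrite addrC addr_eq0 => /eqP /(congr1 (mulmx (invmx (M t)))).
by rewrite mulKmx// mulmxN mulmxA => <-.
Qed.

(** Phrased for a left inverse near [t] instead of [invmx], so that it serves in both directions
    between [1 - W] and its resolvent [T]. *)
Lemma is_mxderive_left_inv n (X Y : R -> 'M[R[i]]_n) t a L :
  (\forall s \near t, Y s *m X s = 1%:M) -> is_mxderive X t (a *: L) ->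
  is_mxderive Y t (- a *: (Y t *m L *m Y t)).
Proof.
move=> YX dX.
have invE : \forall s \near t, invmx (X s) = Y s.
  apply: filterS YX => s YX1; have [_ Xu] := mulmx1_unit YX1.
  by rewrite -[LHS]mul1mx -YX1 mulmxK.
have Xu : \forall s \near t, X s \in unitmx.
  by apply: filterS YX => s /mulmx1_unit[].
have := is_mxderiveV Xu dX; rewrite (nbhs_singleton invE).
rewrite -scalemxAr -scalemxAl -scaleNr.
exact: near_eq_is_mxderive.
Qed.

(** Since [u = Y (X u)] near [t], [u] is derivable as soon as [X] and [X u] are. This is the passage
    between [z = (1 - W) u] and [u]. *)
Lemma is_mxderive_left_inv_mul n m (X Y : R -> 'M[R[i]]_n)
    (u : R -> 'M[R[i]]_(n, m)) t a L H :
  (\forall s \near t, Y s *m X s = 1%:M) -> is_mxderive X t (a *: L) ->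
  is_mxderive (fun s => X s *m u s) t (- a *: H) <->
  is_mxderive u t (- a *: (Y t *m L *m u t + Y t *m H)).
Proof.
move=> YX dX; have YXt := nbhs_singleton YX; have XYt := mulmx1C YXt.
split=> [dz|du].
  have := is_mxderiveM (is_mxderive_left_inv YX dX) dz.
  rewrite -scalemxAl -scalemxAr -scalerDr -[Y t *m L *m Y t *m _]mulmxA.
  rewrite [Y t *m (X t *m _)]mulmxA YXt mul1mx.
  apply: near_eq_is_mxderive; apply: filterS YX => s YXs.
  by rewrite mulmxA YXs mul1mx.
have := is_mxderiveM dX du.
rewrite -scalemxAl -scalemxAr mulmxDr !mulmxA XYt !mul1mx scalerDr addrA.
by rewrite -scalerDl addrN scale0r add0r.
Qed.

End ComplexDerivative.

(** * The equations of motion in the ball *)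

Lemma sum_sj_generator (V : nmodType) n (F : sj_generator n -> V) :
  \sum_g F g = \sum_l F (inl (inl (inl (inl l))))
    + \sum_l F (inl (inl (inl (inr l))))
    + \sum_l \sum_m F (inl (inl (inr (l, m))))
    + \sum_l \sum_m F (inl (inr (l, m))) + \sum_l \sum_m F (inr (l, m)).
Proof.
rewrite !big_sumType /= !pair_bigA /=.
by congr (_ + _ + _ + _ + _); apply: eq_bigr => -[].
Qed.

Section Motion.
Variables (R : realType) (n : nat) (k : R).
Variables (eps : 'cV[R[i]]_n) (e0 em ep : 'M[R[i]]_n).
Hypotheses (em_sym : em = em^T) (ep_sym : ep = ep^T).

Definition ham_field_z (z : 'cV[R[i]]_n) (W : 'M[R[i]]_n) : 'cV[R[i]]_n :=
  eps + W *m mxconj eps + 2^-1 *: (e0^T *m z) + W *m ep *m z.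

Definition ham_field_W (W : 'M[R[i]]_n) : 'M[R[i]]_n :=
  2^-1 *: (e0^T *m W + W *m e0) + em + W *m ep *m W.

Lemma sum_gen_field_z (z : 'cV[R[i]]_n) (W : 'M[R[i]]_n) (i : 'I_n) :
  W^T = W ->
  \sum_g ham_coef eps e0 em ep g * (gen_field g (z, W)).1 i 0
  = ham_field_z z W i 0.
Proof.
move=> Wsym; have Ws p q : W p q = W q p by rewrite -{1}Wsym mxE.
rewrite sum_sj_generator /= /ham_field_z [RHS]mxE [X in _ = X + _]mxE.
rewrite [X in _ = X + _ + _]mxE.
rewrite [X in _ + X + _]big1 ?addr0; last first.
  by move=> l _; rewrite big1// => m _; rewrite mxE mulr0.
congr (_ + _ + _ + _).
- rewrite (bigD1 i)//= mxE !eqxx mulr1 big1 ?addr0// => l li.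
  by rewrite mxE eq_sym (negPf li) mulr0.
- by rewrite mxE; apply: eq_bigr => l _; rewrite !mxE mulrC Ws.
- rewrite !mxE mulr_sumr; apply: eq_bigr => l _.
  rewrite (bigD1 i)//= !mxE !eqxx.
  rewrite big1 ?addr0 => [|m mi]; first by rewrite mulr1; ring.
  by rewrite !mxE eq_sym (negPf mi) !mulr0.
transitivity (\sum_l \sum_m ep l m * W i l * z m 0); last first.
  rewrite mxE exchange_big; apply: eq_bigr => m _; rewrite mxE mulr_suml.
  by apply: eq_bigr => l _; rewrite [W i l * _]mulrC.
(* The two terms of the [K^+] field have equal sums, by exchanging [l] and [m] and the symmetry of
   [ep]; this absorbs the factor [1/2]. *)
pose S := \sum_l \sum_m 2^-1 * (ep l m * W i l * z m 0).
transitivity (S + S).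
  rewrite {2}/S [X in _ = _ + X]exchange_big /= /S -big_split.
  apply: eq_bigr => l _.
  rewrite -big_split; apply: eq_bigr => m _; rewrite !mxE /=.
  have -> : ep m l = ep l m by rewrite [in LHS]ep_sym mxE.
  ring.
rewrite -[S + S]mulr2n -[S *+ 2]mulr_natl /S mulr_sumr; apply: eq_bigr => l _.
rewrite mulr_sumr; apply: eq_bigr => m _.
by rewrite mulrA mulfV ?mul1r// pnatr_eq0.
Qed.

Lemma sum_gen_field_W (z : 'cV[R[i]]_n) (W : 'M[R[i]]_n) : W^T = W ->
  \sum_g ham_coef eps e0 em ep g *: (gen_field g (z, W)).2 = ham_field_W W.
Proof.
move=> Wsym; have Ws p q : W p q = W q p by rewrite -{1}Wsym mxE.
rewrite sum_sj_generator /= /ham_field_W.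
rewrite big1 ?add0r => [|l _]; last by rewrite scaler0.
rewrite big1 ?add0r => [|l _]; last by rewrite scaler0.
congr (_ + _ + _).
(* The [K^0] family contracts [e0^T W] with [sym_delta], so the transpose [W e0] appears with the
   same weight [1/2]. *)
- have -> : W *m e0 = (e0^T *m W)^T by rewrite trmx_mul trmxK Wsym.
  rewrite -sum_sym_delta exchange_big /=; apply: eq_bigr => m _.
  under eq_bigr do rewrite scaler_sumr; rewrite exchange_big /=.
  apply: eq_bigr => i _; rewrite !mxE scaler_suml; apply: eq_bigr => l _.
  by rewrite scalerA !mxE Ws sym_deltaC.
- rewrite sum_sym_delta -em_sym -[em + em]mulr2n -[em *+ 2]scaler_nat.
  by rewrite scalerA mulVf ?scale1r.
(* Being symmetric, [W ep W] equals its own symmetrization, the form that [sum_sym_delta]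
   handles. *)
have WepW : (W *m ep *m W)^T = W *m ep *m W.
  by rewrite !trmx_mul Wsym -ep_sym mulmxA.
transitivity (2^-1 *: (W *m ep *m W + (W *m ep *m W)^T)); last first.
  rewrite WepW -[X in _ *: X]mulr2n -[X in _ *: X]scaler_nat scalerA.
  by rewrite mulVf ?scale1r.
rewrite -sum_sym_delta.
under eq_bigr do under eq_bigr do rewrite scaler_sumr.
under eq_bigr do rewrite exchange_big /=; rewrite exchange_big /=.
apply: eq_bigr => i _.
under eq_bigr do under eq_bigr do rewrite scaler_sumr.
under eq_bigr do rewrite exchange_big /=; rewrite exchange_big /=.
apply: eq_bigr => a _; rewrite mxE scaler_suml exchange_big /=.
apply: eq_bigr => m _; rewrite mxE mulr_suml scaler_suml.
apply: eq_bigr => l _; rewrite scalerA (Ws l i) (Ws a m).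
by congr (_ *: _); ring.
Qed.

(** An entry below the diagonal agrees with its mirror image on a whole neighbourhood of [t], so it
    inherits derivability; symmetry at the single time [t] would not give this. *)
Lemma mxderivable_sym (J : set R) (W : R -> 'M[R[i]]_n) (t : R) :
  open J -> J t -> (forall s, J s -> (W s)^T = W s) ->
  (forall b : {pq : 'I_n * 'I_n | (pq.1 <= pq.2)%N},
    cderivable (fun s => W s (val b).1 (val b).2) t) ->
  mxderivable W t.
Proof.
move=> Jo Jt Ws dW i j; case: (leqP i j) => [ij|/ltnW ji].
  exact: (dW (exist _ (i, j) ij)).
apply: is_cderive_cderivable.
apply: near_eq_is_cderive (cderivable_is (dW (exist _ (j, i) ji))) => /=.
have : \forall s \near t, J s by exact: open_nbhs_nbhs.
by apply: filterS => s /Ws {2}<-; rewrite mxE.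
Qed.

(** The weight [k] enters only the scalar parts of the generators, so it leaves no trace in the
    equations. From here on the differential operators are replaced by matrix calculus. *)
Lemma ball_motionP (J : set R) (c : R -> 'cV[R[i]]_n * 'M[R[i]]_n) :
  open J -> (forall t, J t -> siegel_jacobi_ball (c t)) ->
  ball_motion k eps e0 em ep J c <->
  forall t, J t ->
    is_mxderive (fun s => (c s).1) t (- 'i%C *: ham_field_z (c t).1 (c t).2) /\
    is_mxderive (fun s => (c s).2) t (- 'i%C *: ham_field_W (c t).2).
Proof.
move=> Jo cball.
have Ws s : J s -> (c s).2^T = (c s).2 by case/cball.
have sumQ t b : J t -> \sum_g ham_coef eps e0 em ep g *
    sj_coord_val b (gen_field g (c t))
    = sj_coord_val b (ham_field_z (c t).1 (c t).2, ham_field_W (c t).2).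
  move=> Jt; rewrite [c t]surjective_pairing /=; case: b => [i|pq] /=.
    by rewrite sum_gen_field_z// Ws.
  rewrite -(sum_gen_field_W (c t).1)// ?Ws// summxE.
  by apply: eq_bigr => g _; rewrite mxE.
have iN (a b : R[i]) : 'i%C * a = b <-> a = - 'i%C * b.
  have ii : 'i%C * 'i%C = -1 :> R[i] by rewrite -expr2 sqr_i.
  by split=> [<-|->]; rewrite ?mulNr ?mulrN mulrA ii mulN1r opprK.
have ham_sym t : J t -> (ham_field_W (c t).2)^T = ham_field_W (c t).2.
  move=> Jt; rewrite /ham_field_W 2!linearD /= linearZ /= linearD /=.
  by rewrite !trmx_mul trmxK Ws// -em_sym -ep_sym mulmxA [_ *m e0 + _]addrC.
split=> [[_ [P [Q [PQ dc]]]] t Jt|dc].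
  (* Whatever [Q] the motion comes with, at a point of the ball it agrees with the explicit one. *)
  have Qeq b : \sum_g ham_coef eps e0 em ep g * Q g b (c t)
      = sj_coord_val b (ham_field_z (c t).1 (c t).2, ham_field_W (c t).2).
    rewrite -sumQ//; apply: eq_bigr => g _; congr (_ * _).
    have QQ := acts_as_uniq (PQ g)
      (@gen_op_acts_as _ n (@siegel_jacobi_ball R n) k%:C%C g).
    exact: (QQ _ (cball t Jt) b).
  have dcb b : is_cderive (fun s => sj_coord_val b (c s)) t
      (- 'i%C * sj_coord_val b
        (ham_field_z (c t).1 (c t).2, ham_field_W (c t).2)).
    have [db /iN vb] := dc t Jt b; apply/is_cderiveP; split=> //.
    by rewrite vb Qeq.
  split.
    by move=> i j; rewrite (ord1 j) mxE; exact: (dcb (inl i)).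
  have dW : mxderivable (fun s => (c s).2) t.
    apply: (mxderivable_sym Jo Jt Ws) => b.
    exact: is_cderive_cderivable (dcb (inr b)).
  (* Mirror entries have equal derivatives because [W] is symmetric near [t]; as [ham_field_W] is
     symmetric too, the equation for [p <= q] extends to all entries. *)
  have dWs i j :
      mxdot (fun s => (c s).2) t i j = mxdot (fun s => (c s).2) t j i.
    rewrite !mxE.
    apply: is_cderive_uniq (cderivable_is (dW i j)) _.
    apply: near_eq_is_cderive (cderivable_is (dW j i)).
    have : \forall s \near t, J s by exact: open_nbhs_nbhs.
    by apply: filterS => s /Ws {2}<-; rewrite mxE.
  apply/is_mxderiveP; split => //; apply/matrixP => i j.
  have step (p q : 'I_n) : (p <= q)%N -> mxdot (fun s => (c s).2) t p q
      = (- 'i%C *: ham_field_W (c t).2) p q.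
    move=> pq; have := dcb (inr (exist _ (p, q) pq)) => /= d.
    rewrite [LHS]mxE [RHS]mxE.
    exact: is_cderive_uniq (cderivable_is (dW p q)) d.
  case: (leqP i j) => [/step//|/ltnW/step]; rewrite dWs => ->.
  by rewrite [LHS]mxE [RHS]mxE -{1}ham_sym// mxE.
split=> //; exists (gen_scalar k%:C%C).
exists (fun g b x => sj_coord_val b (gen_field g x)).
split=> [g|t Jt b]; first exact: gen_op_acts_as.
have [dz dW] := dc t Jt.
suff /is_cderiveP [? vb] : is_cderive (fun s => sj_coord_val b (c s)) t
      (- 'i%C * sj_coord_val b
        (ham_field_z (c t).1 (c t).2, ham_field_W (c t).2)).
  by split=> //; apply/iN; rewrite vb sumQ.
case: b => [i|pq] /=.
  by have := dz i 0; rewrite mxE.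
by have := dW (val pq).1 (val pq).2; rewrite mxE.
Qed.
End Motion.

(** * Noncommutative identities *)

Section MatrixIdentities.
(* [I] is an abstract imaginary unit. *)
Variables (F : numFieldType) (I : F).
Hypothesis I2 : I * I = -1.

Lemma addmxE m n (A B : 'M[F]_(m, n)) i j : (A + B) i j = A i j + B i j.
Proof. exact: mxE. Qed.

Lemma oppmxE m n (A : 'M[F]_(m, n)) i j : (- A) i j = - A i j.
Proof. exact: mxE. Qed.

Lemma scalemxE m n a (A : 'M[F]_(m, n)) i j : (a *: A) i j = a * A i j.
Proof. exact: mxE. Qed.

Definition lin_mxE := (addmxE, oppmxE, scalemxE).

Lemma mulZmx m n p a (A : 'M[F]_(m, n)) (B : 'M[F]_(n, p)) :
  (a *: A) *m B = a *: (A *m B).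
Proof. by rewrite scalemxAl. Qed.

Lemma mulmxZ m n p a (A : 'M[F]_(m, n)) (B : 'M[F]_(n, p)) :
  A *m (a *: B) = a *: (A *m B).
Proof. by rewrite scalemxAr. Qed.

(** Expands products into sums of words. On entries, rewriting with [lin_mxE] (unlike [mxE]) leaves
    each word folded, so that it is an atom for [ring] and a noncommutative identity becomes a
    linear one between atoms. *)
Definition mul_mxE :=
  (mulZmx, mulmxZ, mulmxDl, mulmxDr, mulNmx, mulmxN, mulmxA, mul1mx, mulmx1).

Lemma sqr_eqN1_neq0 : I != 0.
Proof.
apply/eqP => I0; move: I2; rewrite I0 mul0r => /eqP.
by rewrite eq_sym oppr_eq0 oner_eq0.
Qed.

Lemma scale_two_i m n (X : 'M[F]_(m, n)) :
  I *: (2 *: (- I *: X) + 0) = 2 *: X.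
Proof. by rewrite addr0 !scalerA; congr (_ *: _); ring: I2. Qed.

Lemma scale_half_i m n (X : 'M[F]_(m, n)) :
  2^-1 *: (0 - I *: (2 *: X)) = - I *: X.
Proof. by rewrite sub0r scalerN -scaleNr !scalerA; congr (_ *: _); field. Qed.

Lemma conj_shift_eq n (S r E : 'M[F]_n) :
  S - I *: r + (- I) *: E = S + I *: r + I *: E - (2 * I) *: (r + E).
Proof. by apply/matrixP => i j; rewrite !lin_mxE; ring. Qed.

Lemma half_shift_eq n (V E : 'M[F]_n) :
  2^-1 *: (E - I *: V) = (2 * I)^-1 *: (V + I *: E).
Proof.
by apply/matrixP => i j; rewrite !lin_mxE; field: I2; exact: sqr_eqN1_neq0.
Qed.

Lemma half_shift_sub1_eq n (V E : 'M[F]_n) :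
  2^-1 *: (E - I *: V) - E = (2 * I)^-1 *: (V - I *: E).
Proof.
by apply/matrixP => i j; rewrite !lin_mxE; field: I2; exact: sqr_eqN1_neq0.
Qed.

(** Resolvent identity [S (A - A') S' = S' - S], meant for [A = v + i], [S = A^-1], [r = Im v] and
    primes for conjugates. It makes [1 - W conj W] congruent to [4 Im v], which transfers
    positivity. *)
Lemma cayley_defect n (A A' S S' r : 'M[F]_n) :
  S *m A = 1%:M -> A' *m S' = 1%:M -> A' = A - (2 * I) *: (r + 1%:M) ->
  1%:M - (1%:M - (2 * I) *: S) *m (1%:M + (2 * I) *: S') = 4 *: (S *m r *m S').
Proof.
move=> SA AS A'E.
have rE : (2 * I) *: r = A - A' - (2 * I) *: 1%:M.
  by rewrite A'E subKr scalerDr addrK.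
have SrS : (2 * I) *: (S *m r *m S') = S' - S - (2 * I) *: (S *m S').
  rewrite -mulZmx -mulmxZ rE !mulmxBr !mulmxBl SA mul1mx -mulmxA AS mulmx1.
  by rewrite mulmxZ mulZmx mulmx1.
have -> : 4 *: (S *m r *m S') = - (2 * I) *: ((2 * I) *: (S *m r *m S')).
  by rewrite scalerA; congr (_ *: _); ring: I2.
by rewrite SrS !mul_mxE; apply/matrixP => i j; rewrite !lin_mxE; ring.
Qed.

(** Changing [I] to [-I] sends [T] to [-(T - 1)] and so swaps the two members of each pair on the
    left; hence [I] disappears from the result. *)
Lemma riccati_half n (P Q M N V : 'M[F]_n) :
  let T := 2^-1 *: (1%:M - I *: V) in
  T *m (2 *: (P + I *: Q)) *m (T - 1%:M)
  + (T - 1%:M) *m (2 *: (P - I *: Q)) *m T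
  + 2 *: (T *m (M + I *: N) *m T + (T - 1%:M) *m (M - I *: N) *m (T - 1%:M))
  = (N + Q) *m V + V *m (N - Q) + (M - P) + V *m (- (M + P)) *m V.
Proof.
move=> T; have -> : T - 1%:M = - (2^-1 *: (1%:M + I *: V)).
  by apply/matrixP => i j; rewrite !lin_mxE; field.
rewrite /T !mul_mxE; apply/matrixP => i j; rewrite !lin_mxE.
by field: I2.
Qed.

(** Each word now contains [T] or [T - 1] only once, so the sum is odd under [I -> -I]; the
    prefactor [- I] makes it even. *)
Lemma affine_half n (P Q M N V : 'M[F]_n) (a b u : 'cV[F]_n) :
  let T := 2^-1 *: (1%:M - I *: V) in
  - I *: (T *m (P + I *: Q) *m u + (T - 1%:M) *m (P - I *: Q) *m u
          + T *m (M + I *: N) *m u + (T - 1%:M) *m (M - I *: N) *m u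
          + T *m (a + I *: b) + (T - 1%:M) *m (a - I *: b))
  = b + V *m (- a) + (N + Q + V *m (- (M + P))) *m u.
Proof.
move=> T; have -> : T - 1%:M = - (2^-1 *: (1%:M + I *: V)).
  by apply/matrixP => i j; rewrite !lin_mxE; field.
rewrite /T !mul_mxE; apply/matrixP => i j; rewrite !lin_mxE.
by field: I2.
Qed.

(** Leibniz rule for [y - W conj y], with [y'], [e'] for conjugates and [e0'] for the transpose. The
    terms in [em y'] and [W e0 y'] cancel, and the rest depends on [y] only through [z]. *)
Lemma conj_riccati n (e0 e0' em ep W : 'M[F]_n) (e e' y y' : 'cV[F]_n) :
  let z := y - W *m y' in
  - I *: (e + em *m y' + 2^-1 *: e0' *m y)
  - ((- I *: (2^-1 *: (e0' *m W + W *m e0) + em + W *m ep *m W)) *m y'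
     + W *m (I *: (e' + ep *m y + 2^-1 *: e0 *m y')))
  = - I *: (e + W *m e' + 2^-1 *: (e0' *m z) + W *m ep *m z).
Proof.
rewrite /= !mul_mxE; apply/matrixP => i j; rewrite !lin_mxE.
by ring.
Qed.

Lemma ball_rhs_W n (e0 e0' em ep W : 'M[F]_n) :
  (- (I / 2) *: e0') *m W + W *m (- (I / 2) *: e0) + (- I *: em)
  + W *m (- I *: ep) *m W
  = - I *: (2^-1 *: (e0' *m W + W *m e0) + em + W *m ep *m W).
Proof.
by rewrite !mul_mxE; apply/matrixP => i j; rewrite !lin_mxE; ring.
Qed.

Lemma ball_rhs_z n (e0' ep W : 'M[F]_n) (e e' z : 'cV[F]_n) :
  (- I *: e + W *m (- I *: e')) + (- (I / 2) *: e0' + W *m (- I *: ep)) *m z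
  = - I *: (e + W *m e' + 2^-1 *: (e0' *m z) + W *m ep *m z).
Proof.
by rewrite !mul_mxE; apply/matrixP => i j; rewrite !lin_mxE; ring.
Qed.

Lemma riccati_resolvent n (e0 e0' em ep W T : 'M[F]_n) :
  T *m W = T - 1%:M -> W *m T = T - 1%:M ->
  2 *: (T *m (2^-1 *: (e0' *m W + W *m e0) + em + W *m ep *m W) *m T)
  = T *m e0' *m (T - 1%:M) + (T - 1%:M) *m e0 *m T
    + 2 *: (T *m em *m T + (T - 1%:M) *m ep *m (T - 1%:M)).
Proof.
move=> TW WT; rewrite -{1 4}WT -TW !mul_mxE; apply/matrixP => i j.
by rewrite !lin_mxE; field.
Qed.

(** Substituting [z = (1 - W) u] cancels every word with [W] next to [u]; each remaining [W] follows
    a [T]. *)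
Lemma affine_resolvent n (e0 e0' em ep W T : 'M[F]_n) (e e' u z : 'cV[F]_n) :
  T *m W = T - 1%:M -> z = (1%:M - W) *m u ->
  T *m (2^-1 *: (e0' *m W + W *m e0) + em + W *m ep *m W) *m u
  + T *m (e + W *m e' + 2^-1 *: (e0' *m z) + W *m ep *m z)
  = T *m (2^-1 *: e0') *m u + (T - 1%:M) *m (2^-1 *: e0) *m u
    + T *m em *m u + (T - 1%:M) *m ep *m u + T *m e + (T - 1%:M) *m e'.
Proof.
move=> TW ->; rewrite -TW !mul_mxE; apply/matrixP => i j.
by rewrite !lin_mxE; ring.
Qed.

End MatrixIdentities.

(** * The partial Cayley transform *)

Section MatrixTools.
Variable R : rcfType.
Local Notation C := R[i].

Lemma mulii : 'i%C * 'i%C = -1 :> C.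
Proof. by rewrite -expr2 sqr_i. Qed.

Lemma conjci : conjc 'i%C = - 'i%C :> C.
Proof. by apply/eqP; rewrite eq_complex /= oppr0 !eqxx. Qed.

Lemma mxconj_tr m n (A : 'M[C]_(m, n)) : mxconj A^T = (mxconj A)^T.
Proof. by rewrite /mxconj map_trmx. Qed.

Lemma conjc2i : conjc (2 * 'i%C) = - (2 * 'i%C) :> C.
Proof.
rewrite [LHS](rmorphM (@conjc R)) -mulrN -conjci; congr (_ * _).
exact: conjc_nat.
Qed.

Lemma conjcNi : conjc (- 'i%C) = 'i%C :> C.
Proof. by rewrite -conjci conjcK. Qed.

Lemma conjc_half : conjc 2^-1 = 2^-1 :> C.
Proof. by rewrite conjc_inv conjc_nat. Qed.

Lemma mxconjK m n : involutive (@mxconj R m n).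
Proof. by move=> A; apply/matrixP => i j; rewrite !mxE conjcK. Qed.

Lemma mxconjM m n p (A : 'M[C]_(m, n)) (B : 'M[C]_(n, p)) :
  mxconj (A *m B) = mxconj A *m mxconj B.
Proof. exact: map_mxM. Qed.

Lemma mxconjD m n (A B : 'M[C]_(m, n)) : mxconj (A + B) = mxconj A + mxconj B.
Proof. exact: map_mxD. Qed.

Lemma mxconjN m n (A : 'M[C]_(m, n)) : mxconj (- A) = - mxconj A.
Proof. exact: map_mxN. Qed.

Lemma mxconjZ m n (a : C) (A : 'M[C]_(m, n)) :
  mxconj (a *: A) = conjc a *: mxconj A.
Proof. exact: map_mxZ. Qed.

Lemma mxconj_scalar n (a : C) : mxconj a%:M = (conjc a)%:M :> 'M[C]_n.
Proof. exact: map_scalar_mx. Qed.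

Lemma mxconj1 n : mxconj 1%:M = 1%:M :> 'M[C]_n.
Proof. exact: map_mx1. Qed.

Lemma mxadjM m n p (A : 'M[C]_(m, n)) (B : 'M[C]_(n, p)) :
  mxadj (A *m B) = mxadj B *m mxadj A.
Proof. by rewrite /mxadj mxconjM trmx_mul. Qed.

Lemma mxadjZ m n (a : C) (A : 'M[C]_(m, n)) :
  mxadj (a *: A) = conjc a *: mxadj A.
Proof. by rewrite /mxadj mxconjZ linearZ. Qed.

Lemma mxadjK m n (A : 'M[C]_(m, n)) : mxadj (mxadj A) = A.
Proof. by rewrite /mxadj /mxconj map_trmx trmxK; exact: mxconjK. Qed.

Lemma mxadj_eq0 m n (A : 'M[C]_(m, n)) : (mxadj A == 0) = (A == 0).
Proof.
apply/eqP/eqP => [A0|->]; last by rewrite /mxadj /mxconj map_mx0 trmx0.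
by rewrite -(mxadjK A) A0 /mxadj /mxconj map_mx0 trmx0.
Qed.

Lemma mxrealD m n (A B : 'M[R]_(m, n)) : mxreal (A + B) = mxreal A + mxreal B.
Proof. exact: map_mxD. Qed.

Lemma mxrealN m n (A : 'M[R]_(m, n)) : mxreal (- A) = - mxreal A.
Proof. exact: map_mxN. Qed.

Lemma mxrealD1 n (A : 'M[R]_n) : mxreal (A + 1%:M) = mxreal A + 1%:M.
Proof. by rewrite /mxreal map_mxD map_mx1. Qed.

Lemma mxrectE m n (A B : 'M[R]_(m, n)) i j :
  mxrect A B i j = (A i j +i* B i j)%C.
Proof. by rewrite !mxE [RHS]complexE. Qed.

Lemma mxrect_inj m n (A B A' B' : 'M[R]_(m, n)) :
  mxrect A B = mxrect A' B' -> A = A' /\ B = B'.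
Proof.
move=> /matrixP AB; split; apply/matrixP => i j; have := AB i j;
by rewrite !mxrectE => -[? ?].
Qed.

Lemma mxrect_tr m n (A B : 'M[R]_(m, n)) : (mxrect A B)^T = mxrect A^T B^T.
Proof. by apply/matrixP => i j; rewrite mxE !mxrectE !mxE. Qed.

Lemma mxrect_conj m n (A B : 'M[R]_(m, n)) :
  mxconj (mxrect A B) = mxrect A (- B).
Proof. by apply/matrixP => i j; rewrite mxE !mxrectE !mxE. Qed.

Lemma mxrectN m n (A B : 'M[R]_(m, n)) :
  mxrect A (- B) = mxreal A - 'i%C *: mxreal B.
Proof. by rewrite /mxrect /mxreal map_mxN scalerN. Qed.

Lemma mxrect_ReIm m n (A : 'M[C]_(m, n)) :
  mxrect (map_mx (@complex.Re R) A) (map_mx (@complex.Im R) A) = A.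
Proof. by apply/matrixP => i j; rewrite mxrectE !mxE; case: (A i j). Qed.

Lemma not_unitmx_ker n (M : 'M[C]_n) :
  M \notin unitmx -> exists2 u : 'rV[C]_n, u != 0 & u *m M = 0.
Proof.
rewrite -row_free_unit -kermx_eq0 => /rowV0Pn[u /sub_kermxP uM u0].
by exists u.
Qed.

Lemma herm_posdef_unit n (M : 'M[C]_n) : herm_posdef M -> M \in unitmx.
Proof.
move=> [_ Mpos]; case: (boolP (M \in unitmx)) => // /not_unitmx_ker[u u0 uM].
have := Mpos (mxadj u); rewrite mxadj_eq0 => /(_ u0).
by rewrite mxadjK uM mul0mx mxE ltxx.
Qed.

Lemma sym_posdef_herm n (r : 'M[R]_n) : sym_posdef r -> herm_posdef (mxreal r).
Proof.
move=> [rsym rpos]; split.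
  by apply/matrixP => i j; rewrite !mxE -[in LHS]rsym mxE; exact: conjc_real.
move=> x x0; pose a := map_mx (@complex.Re R) x.
pose b := map_mx (@complex.Im R) x.
have xE : x = mxrect a b by rewrite mxrect_ReIm.
have adjE : mxadj x = mxreal a^T - 'i%C *: mxreal b^T.
  by rewrite xE /mxadj mxrect_conj mxrect_tr linearN /= mxrectN.
have -> : mxadj x *m mxreal r *m x
    = mxrect (a^T *m r *m a + b^T *m r *m b) (a^T *m r *m b - b^T *m r *m a).
  rewrite adjE xE /mxrect /mxreal !(map_mxD, map_mxN, map_mxM).
  rewrite !(mulmxDl, mulmxDr, mulNmx, mulmxN) -?(scalemxAl, scalemxAr).
  rewrite scalerA mulii scaleN1r opprK scalerBr [X in _ + X]addrC addrACA.
  by rewrite [- _ + _]addrC.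
(* These are one-by-one matrices and transposes of each other, so the imaginary part of the form
   vanishes. *)
have -> : a^T *m r *m b = b^T *m r *m a.
  transitivity (a^T *m r *m b)^T; last by rewrite !trmx_mul trmxK rsym mulmxA.
  by apply/matrixP => i j; rewrite !ord1 [RHS]mxE.
rewrite subrr mxrectE [in X in (X +i* _)%C]mxE [X in (_ +i* X)%C]mxE.
have pos (y : 'cV[R]_n) : 0 <= (y^T *m r *m y) 0 0.
  by case: (eqVneq y 0) => [->|/rpos/ltW//]; rewrite mulmx0 mxE.
suff : 0 < (a^T *m r *m a) 0 0 + (b^T *m r *m b) 0 0.
  by rewrite ltcE /= eqxx.
case: (eqVneq a 0) => [a0|/rpos ap]; last exact: ltr_wpDr.
have /rpos bp : b != 0.
  apply: contra x0 => /eqP b0; rewrite xE a0 b0 /mxrect /mxreal !map_mx0.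
  by rewrite scaler0 addr0.
exact: ltr_wpDl.
Qed.

(** [r + 1] is the imaginary part of [v + i], whose invertibility is the goal. *)
Lemma sym_posdef_add1 n (r : 'M[R]_n) : sym_posdef r -> sym_posdef (r + 1%:M).
Proof.
move=> [rsym rpos]; split=> [|x x0]; first by rewrite linearD /= rsym trmx1.
rewrite mulmxDr mulmxDl mulmx1 mxE ltr_wpDr ?rpos// mxE.
by apply: sumr_ge0 => i _; rewrite mxE -expr2 sqr_ge0.
Qed.

End MatrixTools.

(** * The Cayley transform and its resolvent *)

Section Cayley.
Variables (R : rcfType) (n : nat).
Local Notation C := R[i].
Implicit Types (v W : 'M[C]_n).

Lemma siegel_ball_unit W :
  siegel_ball W -> 1%:M - W *m mxconj W \in unitmx.
Proof. by move=> [_]; exact: herm_posdef_unit. Qed.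

(** If [u W = u] for a row [u], then [u (1 - W conj W) u^dagger = 0], because [conj W] is the
    adjoint of the symmetric [W]; positivity forces [u = 0]. *)
Lemma siegel_ball_unit1 W : siegel_ball W -> 1%:M - W \in unitmx.
Proof.
move=> [Wsym [_ Wpos]]; 
  case: (boolP (1%:M - W \in unitmx)) => // /not_unitmx_ker[u u0].
rewrite mulmxBr mulmx1 => /eqP; rewrite subr_eq0 => /eqP uW.
have := Wpos (mxadj u); rewrite mxadj_eq0 => /(_ u0).
have adjW : mxadj W = mxconj W by rewrite /mxadj /mxconj map_trmx -Wsym.
rewrite mxadjK mulmxBr mulmx1 mulmxA -uW mulmxBl -adjW -mulmxA -mxadjM -uW.
by rewrite subrr mxE ltxx.
Qed.

Lemma siegel_upper_sym v : siegel_upper v -> v^T = v.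
Proof. by move=> [s [r [-> ss [rs _]]]]; rewrite mxrect_tr ss rs. Qed.

Lemma mxconj_shift (s r : 'M[R]_n) :
  mxconj (mxrect s r + 'i%C%:M)
  = mxrect s r + 'i%C%:M - (2 * 'i%C) *: (mxreal r + 1%:M).
Proof.
rewrite mxconjD mxrect_conj mxrectN mxconj_scalar conjci.
rewrite -(scalemx1 _ 'i%C) -(scalemx1 _ (- 'i%C)).
exact: conj_shift_eq.
Qed.

(** If [u (v + i) = 0], the number [u (v + i) u^dagger] and its conjugate vanish, hence so does
    their difference [2 i u (Im v + 1) u^dagger]. *)
Lemma siegel_upper_unit v : siegel_upper v -> v + 'i%C%:M \in unitmx.
Proof.
move=> [s [r [-> ss rpos]]].
case: (boolP (mxrect s r + 'i%C%:M \in unitmx)) => // /not_unitmx_ker[u u0 uv].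
have [rsym _] := rpos.
have /= := (sym_posdef_herm (sym_posdef_add1 rpos)).2 (mxadj u).
rewrite mxadj_eq0 => /(_ u0); rewrite mxadjK.
have ud : u *m (mxrect s r + 'i%C%:M) *m mxadj u = 0 by rewrite uv mul0mx.
have := congr1 (@mxadj R 1 1) ud; rewrite !mxadjM mxadjK mulmxA.
have vs : (mxrect s r + 'i%C%:M)^T = mxrect s r + 'i%C%:M.
  by rewrite linearD /= mxrect_tr ss rsym tr_scalar_mx.
have -> : mxadj (mxrect s r + 'i%C%:M) = mxconj (mxrect s r + 'i%C%:M).
  by rewrite /mxadj /mxconj map_trmx vs.
rewrite mxconj_shift -mxrealD1.
rewrite mulmxBr mulmxBl ud sub0r => /eqP.
rewrite -scalemxAr -scalemxAl /mxadj /mxconj map_mx0 trmx0 oppr_eq0.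
rewrite scaler_eq0 => /orP[|/eqP ->]; last by rewrite mxE ltxx.
rewrite mulf_eq0 pnatr_eq0 /= => /eqP i0; have := mulii R.
by rewrite i0 mul0r => /eqP; rewrite eq_sym oppr_eq0 oner_eq0.
Qed.

(** For invertible [v + i] this is [(v - i)(v + i)^-1], in the form that shows
    [1 - W = 2 i (v + i)^-1] at once. *)
Definition cayley v : 'M[C]_n := 1%:M - (2 * 'i%C) *: invmx (v + 'i%C%:M).

Definition partial_cayley (y : 'M[C]_n * 'cV[C]_n) : 'cV[C]_n * 'M[C]_n :=
  ((1%:M - cayley y.1) *m y.2, cayley y.1).

(* The resolvent [(1 - W)^-1] at [W = cayley v]. *)
Definition cayley_res v : 'M[C]_n := 2^-1 *: (1%:M - 'i%C *: v).

Lemma i_neq0 : 'i%C != 0 :> C.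
Proof. exact: sqr_eqN1_neq0 (mulii R). Qed.

Lemma two_i_neq0 : 2 * 'i%C != 0 :> C.
Proof. by rewrite mulf_neq0 ?pnatr_eq0// i_neq0. Qed.

Lemma cayley_resE v : cayley_res v = (2 * 'i%C)^-1 *: (v + 'i%C%:M).
Proof.
by rewrite /cayley_res -(scalemx1 _ 'i%C); exact: (half_shift_eq (mulii R)).
Qed.

Lemma invmx_left m (A B : 'M[C]_m) : A *m B = 1%:M -> invmx B = A.
Proof.
by move=> AB; have [_ uB] := mulmx1_unit AB; rewrite -[LHS]mul1mx -AB mulmxK.
Qed.

Lemma cayley_resVr v : siegel_upper v ->
  cayley_res v *m (1%:M - cayley v) = 1%:M.
Proof.
move=> /siegel_upper_unit vu; rewrite cayley_resE /cayley subKr.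
by rewrite -scalemxAl -scalemxAr scalerA mulVf ?two_i_neq0// scale1r mulmxV.
Qed.

Lemma cayley_resVl v : siegel_upper v ->
  (1%:M - cayley v) *m cayley_res v = 1%:M.
Proof. by move=> /cayley_resVr/mulmx1C. Qed.

Lemma cayley_resMl v : siegel_upper v ->
  cayley_res v *m cayley v = cayley_res v - 1%:M.
Proof.
by move=> /cayley_resVr <-; rewrite mulmxBr mulmx1 subKr.
Qed.

Lemma cayley_resMr v : siegel_upper v ->
  cayley v *m cayley_res v = cayley_res v - 1%:M.
Proof.
by move=> /cayley_resVl <-; rewrite mulmxBl mul1mx subKr.
Qed.

Lemma cayley_resK v : v = 'i%C *: (2 *: cayley_res v - 1%:M).
Proof.
rewrite /cayley_res scalerA mulfV ?pnatr_eq0// scale1r addrAC subrr add0r.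
by rewrite scalerN scalerA mulii scaleN1r opprK.
Qed.

Lemma cayley_ball v : siegel_upper v -> siegel_ball (cayley v).
Proof.
move=> vup; have vs := siegel_upper_sym vup; have vu := siegel_upper_unit vup.
have Ws : (cayley v)^T = cayley v.
  rewrite /cayley linearB /= linearZ /= trmx1 trmx_inv linearD /= vs.
  by rewrite tr_scalar_mx.
split; first by rewrite Ws.
case: vup => [s [r [vE ss rpos]]].
set A := v + 'i%C%:M in vu *; set S := invmx A.
have Ss : S^T = S by rewrite /S /A trmx_inv linearD /= vs tr_scalar_mx.
have adjS : mxadj S = mxconj S by rewrite /mxadj /mxconj map_trmx Ss.
have cA : mxconj A = A - (2 * 'i%C) *: (mxreal r + 1%:M).
  by rewrite /A vE mxconj_shift.
have cAS : mxconj A *m mxconj S = 1%:M by rewrite -mxconjM mulmxV// mxconj1.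
have -> : 1%:M - cayley v *m mxconj (cayley v)
    = 4 *: (S *m mxreal r *m mxadj S).
  rewrite adjS -(cayley_defect (mulii R) (mulVmx vu) cAS cA) -/S.
  rewrite /cayley -/A -/S mxconjD mxconj1 mxconjN mxconjZ conjc2i.
  by rewrite scaleNr opprK.
have [rh rp] := sym_posdef_herm rpos; split.
  rewrite mxadjZ !mxadjM mxadjK rh.
  by rewrite (conjc_nat R 4) mulmxA.
move=> x x0; have Sx0 : mxadj S *m x != 0.
  apply: contra x0 => /eqP Sx; have := congr1 (mulmx (mxconj A)) Sx.
  by rewrite adjS mulmxA cAS mul1mx mulmx0 => ->.
have := rp _ Sx0; rewrite mxadjM mxadjK !mulmxA => xp.
by rewrite -scalemxAr -scalemxAl scalemxE !mulmxA mulr_gt0// ltr0n.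
Qed.

Lemma partial_cayleyK (y : 'M[C]_n * 'cV[C]_n) : siegel_upper y.1 ->
  partial_cayley_inv (partial_cayley y) = y.
Proof.
move=> yup; rewrite /partial_cayley_inv /= (invmx_left (cayley_resVr yup)).
rewrite mulmxA cayley_resVr// mul1mx mulmxDr mulmx1 cayley_resMl// addrA.
by rewrite -mulr2n -scaler_nat -cayley_resK -surjective_pairing.
Qed.

(** In use the image is a point of a curve given in the upper half plane, so its membership is a
    hypothesis instead of being derived from that of [x]. *)
Lemma partial_cayley_invK (x : 'cV[C]_n * 'M[C]_n) :
  siegel_jacobi_ball x -> siegel_upper (partial_cayley_inv x).1 ->
  partial_cayley (partial_cayley_inv x) = x.
Proof.
case: x => z W /siegel_ball_unit1 /= Wu vup.
pose v := (partial_cayley_inv (z, W)).1.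
(* With [1 = (1 - W)^-1 (1 - W)], the sum [1 - i v] is [(1 - W)^-1] times
   [(1 - W) + (1 + W) = 2]. *)
have TE : cayley_res v = invmx (1%:M - W).
  rewrite /cayley_res /v /= scalerA mulii scaleN1r opprK.
  rewrite -{1}(mulVmx Wu) -mulmxDr addrACA addNr addr0.
  rewrite -[1%:M + 1%:M]mulr2n -[1%:M *+ 2]scaler_nat -scalemxAr mulmx1.
  by rewrite scalerA mulVf ?scale1r// pnatr_eq0.
have WE : cayley v = W.
  have := cayley_resVl vup; rewrite -/v TE => /(congr1 (mulmxr (1%:M - W))).
  by rewrite /= mulmxKV// mul1mx => /addrI/oppr_inj.
by rewrite /partial_cayley -/v WE /= mulmxA mulmxV// mul1mx.
Qed.

(** The two coefficients in [FC1] are [T] and [T - 1 = T W], so [u = T (eta - W conj eta)]. *)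
Lemma partial_cayley_FC1 (eta : 'cV[C]_n) v : siegel_upper v ->
  partial_cayley (FC1 eta v) = FC eta (cayley v).
Proof.
move=> vup; rewrite /partial_cayley /FC1 /FC /=; congr pair.
have -> : (2 * 'i%C)^-1 *: ((v + 'i%C%:M) *m eta - (v - 'i%C%:M) *m mxconj eta)
    = cayley_res v *m eta - (cayley_res v - 1%:M) *m mxconj eta.
  rewrite cayley_resE scalerBr -scalemxAl; congr (_ - _).
  rewrite scalemxAl; congr (_ *m _); rewrite -cayley_resE /cayley_res.
  by rewrite -(scalemx1 _ 'i%C); exact/esym/(half_shift_sub1_eq (mulii R)).
rewrite -cayley_resMl// mulmxBr !mulmxA cayley_resVl// mul1mx.
by rewrite mul1mx.
Qed.

End Cayley.

(** * The equations of motion in the upper half plane *)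

Section CayleyMotion.
Variables (R : realType) (n : nat) (k : R).
Variables (eps : 'cV[R[i]]_n) (e0 em ep : 'M[R[i]]_n).
Variables (ma na pa qa : 'M[R]_n).
Hypotheses (em_sym : em = em^T) (ep_sym : ep = ep^T).
Hypotheses (emE : em = mxrect ma na) (epE : ep = mxrect ma (- na)).
Hypotheses (e0E : 2^-1 *: e0^T = mxrect pa qa).
Hypotheses (e0E' : 2^-1 *: e0 = mxrect pa (- qa)).

Lemma ball_motion_congr (J : set R) (c c' : R -> 'cV[R[i]]_n * 'M[R[i]]_n) :
  open J -> (forall t, J t -> c t = c' t) ->
  ball_motion k eps e0 em ep J c -> ball_motion k eps e0 em ep J c'.
Proof.
move=> Jo cc' mc; have cball t : J t -> siegel_jacobi_ball (c t).
  by case: mc => + _; apply.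
have cball' t : J t -> siegel_jacobi_ball (c' t).
  by move=> Jt; rewrite -cc'//; exact: cball.
apply/ball_motionP => // t Jt.
have [dz dW] := (ball_motionP k eps e0 em_sym ep_sym Jo cball).1 mc t Jt.
have near_cc' : \forall s \near t, c s = c' s.
  have : \forall s \near t, J s by exact: open_nbhs_nbhs.
  by apply: filterS => s /cc'.
rewrite -cc'//; split.
  by apply: near_eq_is_mxderive dz; apply: filterS near_cc' => s ->.
by apply: near_eq_is_mxderive dW; apply: filterS near_cc' => s ->.
Qed.

Lemma upper_motionP (J : set R) (d : R -> 'M[R[i]]_n * 'cV[R[i]]_n) :
  open J -> (forall t, J t -> siegel_jacobi_upper (d t)) ->
  upper_motion k eps e0 em ep J d <->
  ball_motion k eps e0 em ep J (fun t => partial_cayley (d t)).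
Proof.
move=> Jo dup; split=> [[c [mc dc]]|mc].
  apply: (ball_motion_congr Jo _ mc) => t Jt.
  have ct : siegel_jacobi_ball (c t) by case: mc => + _; apply.
  rewrite dc// partial_cayley_invK//.
  by rewrite -dc//; exact: dup.
by exists (fun t => partial_cayley (d t)); split=> // t /dup/partial_cayleyK.
Qed.

Definition upper_field_v (v : 'M[R[i]]_n) : 'M[R[i]]_n :=
  mxreal (na + qa) *m v + v *m mxreal (na - qa) + mxreal (ma - pa)
  + v *m mxreal (- (ma + pa)) *m v.

Definition upper_field_u (v : 'M[R[i]]_n) (u : 'cV[R[i]]_n) : 'cV[R[i]]_n :=
  (mxreal (map_mx (@complex.Im R) eps)
   + v *m mxreal (- map_mx (@complex.Re R) eps))
  + (mxreal (na + qa) + v *m mxreal (- (ma + pa))) *m u.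

Lemma upper_field_vE (v : 'M[R[i]]_n) : siegel_upper v ->
  2 *: (cayley_res v *m ham_field_W e0 em ep (cayley v) *m cayley_res v)
  = upper_field_v v.
Proof.
move=> vup; rewrite /ham_field_W.
rewrite (riccati_resolvent _ _ _ _ (cayley_resMl vup) (cayley_resMr vup)).
have half2 (A : 'M[R[i]]_n) : A = 2 *: (2^-1 *: A).
  by rewrite scalerA mulfV ?scale1r// pnatr_eq0.
rewrite [e0^T]half2 [X in _ *m X *m cayley_res v]half2 e0E e0E' emE epE.
rewrite !mxrectN /mxrect (riccati_half (mulii R)).
by rewrite /upper_field_v !(mxrealD, mxrealN).
Qed.

Lemma upper_field_uE (v : 'M[R[i]]_n) (u : 'cV[R[i]]_n) : siegel_upper v ->
  - 'i%C *: (cayley_res v *m ham_field_W e0 em ep (cayley v) *m u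
    + cayley_res v *m ham_field_z eps e0 ep ((1%:M - cayley v) *m u) (cayley v))
  = upper_field_u v u.
Proof.
move=> vup; rewrite /ham_field_W /ham_field_z.
rewrite (affine_resolvent e0 e0^T em ep eps (mxconj eps) (cayley_resMl vup)
  erefl).
rewrite /upper_field_u; move: (mxrect_ReIm eps).
move: (map_mx _ eps) (map_mx _ eps) => er ei <-.
rewrite e0E e0E' emE epE mxrect_conj !mxrectN /mxrect (affine_half (mulii R)).
by rewrite !(mxrealD, mxrealN).
Qed.

Section AtTime.
Variables (J : set R) (t : R).
Hypotheses (Jo : open J) (Jt : J t).

Let nearJ (P : R -> Prop) : (forall s, J s -> P s) -> \forall s \near t, P s.
Proof.
move=> JP; have : \forall s \near t, J s by exact: open_nbhs_nbhs.
exact: filterS.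
Qed.

Let sub1_derive n' (W : R -> 'M[R[i]]_n') (G : 'M[R[i]]_n') :
  is_mxderive W t (- 'i%C *: G) ->
  is_mxderive (fun s => 1%:M - W s) t ('i%C *: G).
Proof.
move=> dW; have := is_mxderiveD (is_mxderive_cst 1%:M t) (is_mxderiveN dW).
by rewrite add0r scaleNr opprK.
Qed.

Lemma cayley_res_derive (v : R -> 'M[R[i]]_n) (G : 'M[R[i]]_n) :
  (forall s, J s -> siegel_upper (v s)) ->
  is_mxderive (fun s => cayley (v s)) t (- 'i%C *: G) ->
  is_mxderive (fun s => cayley_res (v s)) t
    (- 'i%C *: (cayley_res (v t) *m G *m cayley_res (v t))).
Proof.
move=> vup /sub1_derive; apply: is_mxderive_left_inv.
by apply: nearJ => s /vup/cayley_resVr.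
Qed.

(** Both directions pass through [T]: [v = i (2 T - 1)] is affine in [T], whence the factor
    [2 = 2 i (-i)], and [W = 1 - T^-1] leads back. *)
Lemma cayley_derive (v : R -> 'M[R[i]]_n) (G : 'M[R[i]]_n) :
  (forall s, J s -> siegel_upper (v s)) ->
  is_mxderive (fun s => cayley (v s)) t (- 'i%C *: G) <->
  is_mxderive v t (2 *: (cayley_res (v t) *m G *m cayley_res (v t))).
Proof.
move=> vup; have vt := vup _ Jt; split=> [dW|dv].
  have dT := cayley_res_derive vup dW.
  have := is_mxderiveZ 'i%C (is_mxderiveD (is_mxderiveZ 2 dT)
    (is_mxderive_cst (- 1%:M) t)).
  rewrite (scale_two_i (mulii R)) => dv.
  by apply: eq_is_mxderive dv => s; rewrite -cayley_resK.
have dT : is_mxderive (fun s => cayley_res (v s)) t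
    (- 'i%C *: (cayley_res (v t) *m G *m cayley_res (v t))).
  have := is_mxderiveZ 2^-1 (is_mxderiveD (is_mxderive_cst 1%:M t)
    (is_mxderiveN (is_mxderiveZ 'i%C dv))).
  by rewrite scale_half_i.
have d1W : is_mxderive (fun s => 1%:M - cayley (v s)) t
    (- - 'i%C *: ((1%:M - cayley (v t))
      *m (cayley_res (v t) *m G *m cayley_res (v t))
      *m (1%:M - cayley (v t)))).
  apply: is_mxderive_left_inv dT.
  by apply: nearJ => s /vup/cayley_resVl.
have GE : (1%:M - cayley (v t)) *m (cayley_res (v t) *m G *m cayley_res (v t))
    *m (1%:M - cayley (v t)) = G.
  rewrite -mulmxA -[_ *m G *m _]mulmxA.
  rewrite -[cayley_res _ *m (G *m _) *m _]mulmxA.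
  rewrite [X in X = _]mulmxA (cayley_resVl vt) mul1mx -mulmxA.
  by rewrite (cayley_resVr vt) mulmx1.
rewrite GE in d1W.
have := is_mxderiveD (is_mxderive_cst 1%:M t) (is_mxderiveN d1W).
rewrite add0r opprK scaleNr => dW.
by apply: eq_is_mxderive dW => s; rewrite subKr.
Qed.

Lemma cayley_derive_z (v : R -> 'M[R[i]]_n) (u : R -> 'cV[R[i]]_n)
    (G : 'M[R[i]]_n) (H : 'cV[R[i]]_n) :
  (forall s, J s -> siegel_upper (v s)) ->
  is_mxderive (fun s => cayley (v s)) t (- 'i%C *: G) ->
  is_mxderive (fun s => (1%:M - cayley (v s)) *m u s) t (- 'i%C *: H) <->
  is_mxderive u t
    (- 'i%C *: (cayley_res (v t) *m G *m u t + cayley_res (v t) *m H)).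
Proof.
move=> vup dW.
apply: (is_mxderive_left_inv_mul (Y := fun s => cayley_res (v s))).
  by apply: nearJ => s /vup/cayley_resVr.
exact: sub1_derive.
Qed.

End AtTime.
End CayleyMotion.

(** * Decoupling *)

Section FCMotion.
Variables (R : realType) (n : nat).
Variables (eps : 'cV[R[i]]_n) (e0 em ep : 'M[R[i]]_n).
Hypotheses (conj_em : mxconj em = ep) (conj_e0 : mxconj e0^T = e0).

Definition eta_field (y : 'cV[R[i]]_n) : 'cV[R[i]]_n :=
  eps + em *m mxconj y + 2^-1 *: e0^T *m y.

Lemma mxconj_eta_field (y : 'cV[R[i]]_n) :
  mxconj (- 'i%C *: eta_field y)
  = 'i%C *: (mxconj eps + ep *m y + 2^-1 *: e0 *m mxconj y).
Proof.
by rewrite mxconjZ conjcNi !mxconjD !mxconjM mxconjZ conjc_half mxconjK conj_em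
  conj_e0.
Qed.

Lemma FC_field (W : 'M[R[i]]_n) (y : 'cV[R[i]]_n) :
  - 'i%C *: eta_field y
  - ((- 'i%C *: ham_field_W e0 em ep W) *m mxconj y
     + W *m mxconj (- 'i%C *: eta_field y))
  = - 'i%C *: ham_field_z eps e0 ep (y - W *m mxconj y) W.
Proof. by rewrite mxconj_eta_field; exact: conj_riccati. Qed.

Lemma sub_conj_inj (W : 'M[R[i]]_n) (x y : 'cV[R[i]]_n) :
  1%:M - W *m mxconj W \in unitmx ->
  x - W *m mxconj x = y - W *m mxconj y -> x = y.
Proof.
move=> Wu xy; apply/eqP; rewrite -subr_eq0; apply/eqP; set d := x - y.
have dW : d = W *m mxconj d.
  rewrite /d mxconjD mxconjN mulmxBr; apply/eqP; rewrite subr_eq.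
  by rewrite -{1}(subrK (W *m mxconj x) x) xy addrC addrA addrAC.
have cd : mxconj d = mxconj W *m d by rewrite {1}dW mxconjM mxconjK.
apply: (can_inj (mulKmx Wu)).
by rewrite mulmx0 mulmxBl mul1mx -mulmxA -cd -dW subrr.
Qed.

Lemma FC_derive (J : set R) (t : R) (eta : R -> 'cV[R[i]]_n)
    (W : R -> 'M[R[i]]_n) :
  open J -> J t -> (forall s, J s -> siegel_ball (W s)) ->
  is_mxderive W t (- 'i%C *: ham_field_W e0 em ep (W t)) ->
  is_mxderive (fun s => eta s - W s *m mxconj (eta s)) t
    (- 'i%C *: ham_field_z eps e0 ep (eta t - W t *m mxconj (eta t)) (W t)) <->
  is_mxderive eta t (- 'i%C *: eta_field (eta t)).
Proof.
move=> Jo Jt Wball dW; rewrite -FC_field.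
split=> [dz|deta]; last first.
  exact: is_mxderiveD deta
    (is_mxderiveN (is_mxderiveM dW (is_mxderive_conj deta))).
have unear : \forall s \near t, 1%:M - W s *m mxconj (W s) \in unitmx.
  have : \forall s \near t, J s by exact: open_nbhs_nbhs.
  by apply: filterS => s /Wball/siegel_ball_unit.
have etaE s : 1%:M - W s *m mxconj (W s) \in unitmx ->
    invmx (1%:M - W s *m mxconj (W s)) *m (eta s - W s *m mxconj (eta s)
      + W s *m mxconj (eta s - W s *m mxconj (eta s))) = eta s.
  move=> Wu; apply: (canLR (mulKmx Wu)).
  rewrite mxconjD mxconjN mxconjM mxconjK mulmxDr mulmxN addrA subrK.
  by rewrite mulmxBl mul1mx mulmxA.
(* Only the existence of a derivative is taken from [etaE]; its value is then identified by the
   injectivity of [y |-> y - W conj y]. *)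
have [zeta deta] : exists zeta, is_mxderive eta t zeta.
  have dN := is_mxderiveD (is_mxderive_cst 1%:M t)
    (is_mxderiveN (is_mxderiveM dW (is_mxderive_conj dW))).
  have dy := is_mxderiveM (is_mxderiveV unear dN)
    (is_mxderiveD dz (is_mxderiveM dW (is_mxderive_conj dz))).
  eexists; apply: near_eq_is_mxderive dy.
  by apply: filterS unear => s /etaE.
have dz' := is_mxderiveD deta
  (is_mxderiveN (is_mxderiveM dW (is_mxderive_conj deta))).
(* Two expressions for the derivative of the same [z] share the contribution [a] of the derivative
   of [W], so [zeta] and the expected velocity have the same image under that map. *)
pose a := (- 'i%C *: ham_field_W e0 em ep (W t)) *m mxconj (eta t).
have := is_mxderive_uniq dz' dz; rewrite -/a !opprD !addrA => E.
suff <- : zeta = - 'i%C *: eta_field (eta t) by [].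
apply: (sub_conj_inj (nbhs_singleton unear)).
by apply: (addIr (- a)); rewrite addrAC E [RHS]addrAC.
Qed.
End FCMotion.

(** * Assembly of the four clauses *)

Lemma is_mxderive2P (R : realType) m n p q (M : R -> 'M[R[i]]_(m, n))
    (N : R -> 'M[R[i]]_(p, q)) t L P :
  [/\ mxderivable M t, mxdot M t = L, mxderivable N t & mxdot N t = P] <->
  is_mxderive M t L /\ is_mxderive N t P.
Proof.
split=> [[dM ML dN NP]|[/is_mxderiveP[? ?] /is_mxderiveP[? ?]]]; last by split.
by split; apply/is_mxderiveP.
Qed.

Lemma scale_i_eq (R : rcfType) m n (A B : 'M[R[i]]_(m, n)) :
  'i%C *: A = B <-> A = - 'i%C *: B.
Proof.
split=> [<-|->]; first by rewrite scalerA mulNr mulii opprK scale1r.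
by rewrite scalerA mulrN mulii opprK scale1r.
Qed.

Theorem proposition6 (R : realType) (n : nat) (n_ge1 : (1 <= n)%N) (k : R)
    (eps : 'cV[R[i]]_n) (e0 em ep : 'M[R[i]]_n)
    (e0_herm : mxadj e0 = e0) (em_sym : em = em^T) (ep_sym : ep = ep^T)
    (ep_adj : mxadj ep = em)
    (ma na pa qa : 'M[R]_n)
    (em_split : em = mxrect ma na) (e0_split : 2^-1 *: e0^T = mxrect pa qa)
    (J : set R) (J_open : open J) (J_itv : is_interval J) :
  [/\ ma = ma^T, na = na^T, pa = pa^T & qa^T = - qa]
  /\
  (* a) *)
  (let A : 'M[R[i]]_n := - ('i%C / 2) *: e0^T in
   let B : 'M[R[i]]_n := - 'i%C *: em in
   let C : 'M[R[i]]_n := - 'i%C *: ep in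
   let D : 'M[R[i]]_n := A^T in
   let E : 'cV[R[i]]_n := - 'i%C *: eps in
   let F : 'cV[R[i]]_n := - 'i%C *: mxconj eps in
   forall (z : R -> 'cV[R[i]]_n) (W : R -> 'M[R[i]]_n),
   (forall t, J t -> siegel_jacobi_ball (z t, W t)) ->
   ball_motion k eps e0 em ep J (fun t => (z t, W t)) <->
   (forall t, J t ->
     [/\ mxderivable W t,
         mxdot W t = A *m W t + W t *m D + B + W t *m C *m W t,
         mxderivable z t &
         mxdot z t = (E + W t *m F) + (A + W t *m C) *m z t]))
  /\
  (* b) *)
  (let A : 'M[R[i]]_n := mxreal (na + qa) in
   let B : 'M[R[i]]_n := mxreal (ma - pa) in
   let C : 'M[R[i]]_n := mxreal (- (ma + pa)) in
   let D : 'M[R[i]]_n := mxreal (na - qa) in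
   let E : 'cV[R[i]]_n := mxreal (map_mx (@complex.Im R) eps) in
   let F : 'cV[R[i]]_n := mxreal (- map_mx (@complex.Re R) eps) in
   forall (v : R -> 'M[R[i]]_n) (u : R -> 'cV[R[i]]_n),
   (forall t, J t -> siegel_jacobi_upper (v t, u t)) ->
   upper_motion k eps e0 em ep J (fun t => (v t, u t)) <->
   (forall t, J t ->
     [/\ mxderivable v t,
         mxdot v t = A *m v t + v t *m D + B + v t *m C *m v t,
         mxderivable u t &
         mxdot u t = (E + v t *m F) + (A + v t *m C) *m u t]))
  /\
  (* c) *)
  (let A : 'M[R[i]]_n := - ('i%C / 2) *: e0^T in
   let B : 'M[R[i]]_n := - 'i%C *: em in
   let C : 'M[R[i]]_n := - 'i%C *: ep in
   let D : 'M[R[i]]_n := A^T in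
   forall (eta : R -> 'cV[R[i]]_n) (W : R -> 'M[R[i]]_n),
   (forall t, J t -> siegel_ball (W t)) ->
   ball_motion k eps e0 em ep J (fun t => FC (eta t) (W t)) <->
   (forall t, J t ->
     [/\ mxderivable W t,
         mxdot W t = A *m W t + W t *m D + B + W t *m C *m W t,
         mxderivable eta t &
         'i%C *: mxdot eta t
           = eps + em *m mxconj (eta t) + (2^-1 *: e0^T) *m eta t]))
  /\
  (* d) *)
  (let A : 'M[R[i]]_n := mxreal (na + qa) in
   let B : 'M[R[i]]_n := mxreal (ma - pa) in
   let C : 'M[R[i]]_n := mxreal (- (ma + pa)) in
   let D : 'M[R[i]]_n := mxreal (na - qa) in
   forall (eta : R -> 'cV[R[i]]_n) (v : R -> 'M[R[i]]_n),
   (forall t, J t -> siegel_upper (v t)) ->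
   upper_motion k eps e0 em ep J (fun t => FC1 (eta t) (v t)) <->
   (forall t, J t ->
     [/\ mxderivable v t,
         mxdot v t = A *m v t + v t *m D + B + v t *m C *m v t,
         mxderivable eta t &
         'i%C *: mxdot eta t
           = eps + em *m mxconj (eta t) + (2^-1 *: e0^T) *m eta t])).
Proof.
have em_conj : mxconj em = ep.
  by rewrite -ep_adj /mxadj mxconj_tr mxconjK -ep_sym.
have e0_conj : mxconj e0^T = e0 by rewrite -[RHS]e0_herm mxconj_tr.
have [ma_sym na_sym] : ma^T = ma /\ na^T = na.
  by apply: mxrect_inj; rewrite -mxrect_tr -em_split -em_sym.
have e0_split' : 2^-1 *: e0 = mxrect pa (- qa).
  by rewrite -mxrect_conj -e0_split mxconjZ conjc_half e0_conj.
(* By hermiticity the transpose [1/2 e0] of [1/2 e0^T] is also its conjugate; compare real and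
   imaginary parts. *)
have [pa_sym qa_sym] : pa^T = pa /\ qa^T = - qa.
  apply: mxrect_inj; rewrite -mxrect_tr -e0_split -e0_split'.
  by rewrite linearZ /= trmxK.
have ep_split : ep = mxrect ma (- na) by rewrite -em_conj em_split mxrect_conj.
split; first by split.
have ballW (W : R -> 'M[R[i]]_n) t :
    (- ('i%C / 2) *: e0^T) *m W t + W t *m (- ('i%C / 2) *: e0^T)^T
      + (- 'i%C *: em) + W t *m (- 'i%C *: ep) *m W t
    = - 'i%C *: ham_field_W e0 em ep (W t).
  by rewrite linearZ /= trmxK ball_rhs_W.
(* Serves c) directly and d) along [W = cayley v]. *)
have FC_motion (eta : R -> 'cV[R[i]]_n) (W : R -> 'M[R[i]]_n) :
    (forall t, J t -> siegel_ball (W t)) ->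
    ball_motion k eps e0 em ep J (fun t => FC (eta t) (W t)) <->
    (forall t, J t ->
      is_mxderive W t (- 'i%C *: ham_field_W e0 em ep (W t)) /\
      is_mxderive eta t (- 'i%C *: eta_field eps e0 em (eta t))).
  move=> Wball; have FCP t Jt :=
    @FC_derive _ _ eps _ _ _ em_conj e0_conj J t eta W J_open Jt Wball.
  have FCball t : J t -> siegel_jacobi_ball (FC (eta t) (W t)) by exact: Wball.
  split=> [/(ball_motionP k eps e0 em_sym ep_sym J_open FCball) H t Jt|H].
    by have [/= dz dW] := H t Jt; split; last exact/FCP.
  apply/(ball_motionP k eps e0 em_sym ep_sym J_open FCball) => t Jt.
  by have [dW deta] := H t Jt; split; first exact/FCP.
have cayleyP (v : R -> 'M[R[i]]_n) t :
    J t -> (forall s, J s -> siegel_upper (v s)) ->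
    is_mxderive (fun s => cayley (v s)) t
      (- 'i%C *: ham_field_W e0 em ep (cayley (v t))) <->
    is_mxderive v t (upper_field_v ma na pa qa (v t)).
  move=> Jt vup.
  have := cayley_derive J_open Jt (ham_field_W e0 em ep (cayley (v t))) vup.
  by rewrite (upper_field_vE em_split ep_split e0_split e0_split' (vup _ Jt)).
split.
  move=> A B C D E F z W ball.
  split=> [/(ball_motionP k eps e0 em_sym ep_sym J_open ball) H t Jt|H].
    have [dz dW] := H t Jt; apply/is_mxderive2P.
    by rewrite /D /A /B /C /E /F ballW ball_rhs_z.
  apply/(ball_motionP k eps e0 em_sym ep_sym J_open ball) => t Jt.
  have /is_mxderive2P [] := H t Jt.
  by rewrite /D /A /B /C /E /F ballW ball_rhs_z.
split.
  move=> A B C D E F v u upper.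
  have cballP t : J t -> siegel_jacobi_ball (partial_cayley (v t, u t)).
    by move=> /upper/cayley_ball.
  (* The equation for [v] is a premise because [z = (1 - W) u] varies with [W] as well as with
     [u]. *)
  have uP t : J t -> is_mxderive v t (upper_field_v ma na pa qa (v t)) ->
      is_mxderive (fun s => (1%:M - cayley (v s)) *m u s) t
        (- 'i%C *: ham_field_z eps e0 ep ((1%:M - cayley (v t)) *m u t)
          (cayley (v t))) <->
      is_mxderive u t (upper_field_u eps ma na pa qa (v t) (u t)).
    move=> Jt /(cayleyP _ _ Jt upper) dW.
    rewrite -(upper_field_uE eps em_split ep_split e0_split e0_split' _
      (upper _ Jt)).
    by apply: (cayley_derive_z J_open Jt) dW; exact: upper.
  split=> [/(upper_motionP k eps e0 em_sym ep_sym J_open upper) mc t Jt|H].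
    have [dz dW] :=
      (ball_motionP k eps e0 em_sym ep_sym J_open cballP).1 mc t Jt.
    have dv := (cayleyP _ _ Jt upper).1 dW.
    by apply/is_mxderive2P; split; [exact: dv | exact: (uP _ Jt dv).1].
  apply/(upper_motionP k eps e0 em_sym ep_sym J_open upper).
  apply/(ball_motionP k eps e0 em_sym ep_sym J_open cballP) => t Jt.
  have /is_mxderive2P [dv du] := H t Jt.
  by split; [exact: ((uP _ Jt dv).2 du) | exact: ((cayleyP _ _ Jt upper).2 dv)].
split.
  move=> A B C D eta W ball; split=> [/(FC_motion _ _ ball) H t Jt|H].
    have /is_mxderive2P [dW WE deta etaE] := H t Jt.
    by split=> //; [rewrite /D /A /B /C ballW | exact/scale_i_eq].
  apply/(FC_motion _ _ ball) => t Jt; have [dW WE deta etaE] := H t Jt.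
  apply/is_mxderive2P; split=> //; last exact/scale_i_eq.
  by rewrite WE /D /A /B /C ballW.
move=> A B C D eta v upper.
have cball t : J t -> siegel_ball (cayley (v t)) by move=> /upper/cayley_ball.
have upperJ t : J t -> siegel_jacobi_upper (FC1 (eta t) (v t)) by exact: upper.
have FCE t : J t ->
    partial_cayley (FC1 (eta t) (v t)) = FC (eta t) (cayley (v t)).
  by move=> /upper/partial_cayley_FC1.
split=> [/(upper_motionP k eps e0 em_sym ep_sym J_open upperJ) mc t Jt|H].
  have := ball_motion_congr (k := k) em_sym ep_sym J_open FCE mc.
  move=> /(FC_motion _ _ cball) /(_ t Jt) [dW deta].
  have dv := (cayleyP _ _ Jt upper).1 dW.
  have /is_mxderive2P [? ? ? etaE] := conj dv deta.
  by split=> //; exact/scale_i_eq.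
apply/(upper_motionP k eps e0 em_sym ep_sym J_open upperJ).
apply: (ball_motion_congr em_sym ep_sym J_open (fun t Jt => esym (FCE t Jt))).
apply/(FC_motion _ _ cball) => t Jt; have [dv vE deta etaE] := H t Jt.
have /is_mxderive2P [dv' deta'] : [/\ mxderivable v t,
    mxdot v t = upper_field_v ma na pa qa (v t), mxderivable eta t &
    mxdot eta t = - 'i%C *: eta_field eps e0 em (eta t)].
  by split=> //; exact/scale_i_eq.
by split=> //; exact: (cayleyP _ _ Jt upper).2.
Qed.
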